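(* Let $d\ge 2$ and let $\mathcal L,\mathcal L_0\subset\mathbb R^d$ be unimodular lattices. There is a set $P\subset\mathbb R^d$ of full Lebesgue measure such that for every $\vec\alpha\in P$, every $\vec\alpha_0\in\mathbb R^d$ and every sub-exponential sequence $(N_i)_i$, $$\limsup_{i\to\infty} g_{N_i}(\vec\alpha,\mathcal L)\ \ge\ \sup_{N\in\mathbb N} g_N(\vec\alpha_0,\mathcal L_0).$$
   Context: A unimodular lattice is a lattice in $\mathbb R^d$ of covolume $1$. For $\vec\alpha\in\mathbb R^d$, a unimodular lattice $\mathcal L$ and $1\le n\le N$, set $\delta_{n,N}=\min\{|(m-n)\vec\alpha+\vec\ell|>0 : 1\le m\le N,\ \vec\ell\in\mathcal L\}$ (Euclidean norm), the distance from $n\vec\alpha+\mathcal L$ to its nearest neighbour among $\{m\vec\alpha+\mathcal L:1\le m\le N\}$ in the torus $\mathbb R^d/\mathcal L$, and $g_N(\vec\alpha,\mathcal L)=|\{\delta_{n,N}:1\le n\le N\}|$. A sequence of integers $N_1<N_2<\cdots$ is sub-exponential if $N_{i+1}/N_i\to 1$ as $i\to\infty$. *)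

(* Defs.v *)
From mathcomp Require Import all_boot all_order all_algebra.
From mathcomp Require Import all_classical all_reals all_analysis.
Set Implicit Arguments. Unset Strict Implicit. Unset Printing Implicit Defensive.
Import Order.TTheory GRing.Theory Num.Theory numFieldNormedType.Exports.
Local Open Scope classical_set_scope.
Local Open Scope ring_scope.

Section Defs.
Variable R : realType.

Definition eucl_norm (d : nat) (v : 'rV[R]_d) : R :=
  Num.sqrt (\sum_(i < d) v ord0 i ^+ 2).

Definition lattice (d : nat) (B : 'M[R]_d) : set 'rV[R]_d :=
  [set l | exists z : 'rV[int]_d, l = map_mx intr z *m B].

Definition unimodular (d : nat) (B : 'M[R]_d) : Prop := `|\det B| = 1.

(* delta_{n,N}(alpha, L): minimal positive distance |(m-n) alpha + l|,
   1 <= m <= N, l in L (the minimum exists by discreteness; we take the inf). *)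
Definition delta (d : nat) (alpha : 'rV[R]_d) (B : 'M[R]_d) (n N : nat) : R :=
  inf [set r : R | exists (m : nat) (l : 'rV[R]_d),
         [/\ (1 <= m <= N)%N, lattice B l,
             r = eucl_norm (((m%:R - n%:R) : R) *: alpha + l) & 0 < r]].

Definition gN (d : nat) (alpha : 'rV[R]_d) (B : 'M[R]_d) (N : nat) : nat :=
  size (undup [seq delta alpha B n N | n <- iota 1 N]).

Definition box (d : nat) (a b : 'rV[R]_d) : set 'rV[R]_d :=
  [set x | forall i : 'I_d, a ord0 i <= x ord0 i <= b ord0 i].
Definition box_vol (d : nat) (a b : 'rV[R]_d) : R :=
  \prod_(i < d) (b ord0 i - a ord0 i).

Definition lebesgue_null (d : nat) (A : set 'rV[R]_d) : Prop :=
  forall eps : R, 0 < eps ->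
    exists a b : nat -> 'rV[R]_d,
      [/\ (forall k i, a k ord0 i <= b k ord0 i),
          A `<=` \bigcup_k box (a k) (b k)
        & forall n, \sum_(k < n) box_vol (a k) (b k) <= eps].

Definition full_measure (d : nat) (P : set 'rV[R]_d) : Prop :=
  lebesgue_null (~` P).

Definition subexponential (N : nat -> nat) : Prop :=
  [/\ (forall i, (0 < N i)%N), (forall i, (N i < N i.+1)%N)
    & (fun i => (N i.+1)%:R / (N i)%:R : R) @ \oo --> (1 : R)].

End Defs.

(* Main.v *)
(* In coordinates where L = Z^d, the numbers g_N(alpha, L) only depend on the shape of the lattice
   Z^(1+d) [[1, alpha], [0, I]] diag(t^-d, t I) with t^d close to N / M, and a lattice close to
   [[1, alpha0], [0, B0]], with B0 a basis of L0, realizes at least g_M(alpha0, L0) distances (if alpha0 has order less than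
   M modulo L0, then g_M <= 1).  So it suffices that for almost every alpha these lattices come
   arbitrarily close to a given one for arbitrarily large t; sub-exponentiality then provides an N_i
   at the right scale.

   Density is obtained without ergodic theory.  At scale t, most alpha in a given cube give a lattice
   without short vectors (union bound), hence with a bounded basis.  From a bounded basis one reaches
   any target by a bounded move of alpha, of size t^-(d+1), and a bounded change of t: this follows
   from compactness and from the fact that limits of rescaled integer unimodular matrices form a
   semigroup containing all matrices with zero first row and column.  So a fixed proportion of
   every cube is covered by cells close to the target, and iterating inside the other cells shows
   that the exceptional set is null. *)
Require Import Defs.
From mathcomp Require Import all_boot all_order all_algebra all_fingroup.
From mathcomp Require Import all_classical all_reals all_analysis.
From mathcomp Require Import ring lra zify.
Import Order.TTheory GRing.Theory Num.Theory numFieldNormedType.Exports.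
Local Open Scope classical_set_scope.
Local Open Scope ring_scope.

(** * Matrix norms and limits of rescaled unimodular integer matrices *)

Local Notation zmx := (map_mx (intr : int -> _)).

(** The obstacle is that [tau] cannot be prescribed when a lattice is steered: it comes out of an
    approximation by integer matrices. Only a lower bound for it is kept; this suffices because
    hitting times need only be arbitrarily large and a sub-exponential sequence meets every large
    scale. The proportion of a cube gained in each round must not depend on the cube or on t.
    Compactness provides this at scale one: commuting a move with the flow rescales it by t^-(d+1),
    so one radius around one bounded move serves all bounded bases, and the grids have a mesh of
    that order. Measure is replaced by counting corners of cells. For given L and L0 the lower block
    of the target, [B0 *m invmx B], is fixed and only its first row depends on alpha0; rational
    first rows approximate it, so countably many null sets are discarded and P depends on neither
    alpha0 nor the sequence. *)

Lemma mx_entry_le {R : realType} {m n : nat} (A : 'M[R]_(m, n)) i j : `|A i j| <= `|A|.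
Proof.
rewrite [leRHS]/Num.norm /= mx_normrE.
by apply: (le_trans _ (le_bigmax _ _ (i, j))).
Qed.

Lemma mx_norm_le {R : realType} {m n : nat} (A : 'M[R]_(m, n)) (e : R) :
  0 <= e -> (forall i j, `|A i j| <= e) -> `|A| <= e.
Proof.
move=> e0 Ae; rewrite [leLHS]/Num.norm /= mx_normrE.
by apply: bigmax_le => // -[i j] _; exact: Ae.
Qed.

Lemma mx_norm_lt {R : realType} {m n : nat} (A : 'M[R]_(m, n)) (e : R) :
  0 < e -> (forall i j, `|A i j| < e) -> `|A| < e.
Proof.
move=> e0 Ae; rewrite [ltLHS]/Num.norm /= mx_normrE.
by apply: bigmax_lt => // -[i j] _; exact: Ae.
Qed.

Lemma mx_norm_mul {R : realType} {m n p : nat} (A : 'M[R]_(m, n)) (B : 'M[R]_(n, p)) :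
  `|A *m B| <= n%:R * `|A| * `|B|.
Proof.
apply: mx_norm_le => [|i j]; first by rewrite !mulr_ge0.
rewrite mxE (le_trans (ler_norm_sum _ _ _))//.
rewrite -mulrA -[n in n%:R]card_ord -sumr_const mulr_suml ler_sum// => k _.
by rewrite mul1r normrM ler_pM// mx_entry_le.
Qed.

(** Closure of the positive real multiples of GL_n(Z). The factor [tau] is free: it has to grow
    along approximations of a singular [X], and is 1 when [X] is itself a unimodular integer
    matrix. *)
Definition scaled_gl {R : realType} {n : nat} (X : 'M[R]_n) : Prop :=
  forall e : R, 0 < e -> exists tau : R, 0 < tau /\
    exists2 D : 'M[int]_n, D \in unitmx & `|tau^-1 *: zmx D - X| < e.

Lemma scaled_gl_unit {R : realType} {n : nat} (D : 'M[int]_n) :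
  D \in unitmx -> scaled_gl (zmx D : 'M[R]_n).
Proof.
by move=> uD e e0; exists 1; split=> //; exists D => //; rewrite invr1 scale1r subrr normr0.
Qed.

Lemma scaled_gl_mul {R : realType} {n : nat} (X Y : 'M[R]_n) :
  scaled_gl X -> scaled_gl Y -> scaled_gl (X *m Y).
Proof.
move=> SX SY e e0.
(* With errors e / c in both factors, the splitting (U' - X) V' + X (V' - Y) costs at most (e / c)
   (c - 1); the cap 1 in the choice of V keeps |V'| below |Y| + 1. *)
pose c : R := n%:R * (`|X| + `|Y| + 1) + 1.
have c0 : 0 < c by rewrite ltr_wpDl// mulr_ge0// !addr_ge0.
have [s [s0 [U uU XU]]] := SX _ (divr_gt0 e0 c0).
have [t [t0 [V uV YV]]] : exists tau : R, 0 < tau /\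
    exists2 D : 'M[int]_n, D \in unitmx & `|tau^-1 *: zmx D - Y| < Num.min 1 (e / c).
  by apply: SY; rewrite lt_min ltr01 divr_gt0.
exists (s * t); split; first exact: mulr_gt0.
exists (U *m V); first by rewrite unitmx_mul uU.
rewrite map_mxM/= invfM -scalerA.
set U' := s^-1 *: zmx U in XU; set V' := t^-1 *: zmx V in YV.
have -> : s^-1 *: (t^-1 *: (zmx U *m zmx V)) = U' *m V' by rewrite -scalemxAl -scalemxAr.
move: YV; rewrite lt_min => /andP[YV1 YV].
have V'le : `|V'| <= `|Y| + 1.
  by rewrite -(subrK Y V') (le_trans (ler_normD _ _))// addrC lerD2l ltW.
have -> : U' *m V' - X *m Y = (U' - X) *m V' + X *m (V' - Y).
  by rewrite mulmxBl mulmxBr addrA subrK.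
apply: le_lt_trans (ler_normD _ _) _.
apply: le_lt_trans (lerD (mx_norm_mul _ _) (mx_norm_mul _ _)) _.
have ec0 : 0 < e / c by exact: divr_gt0.
apply: (@le_lt_trans _ _ (n%:R * (e / c) * (`|Y| + 1) + n%:R * `|X| * (e / c))).
  apply: lerD; last by rewrite ler_wpM2l ?mulr_ge0// ltW.
  by apply: ler_pM; rewrite ?mulr_ge0// ler_wpM2l// ltW.
rewrite (_ : _ + _ = (e / c) * (c - 1)); last by rewrite /c; ring.
by rewrite mulrBr mulr1 divfK ?gt_eqF// ltrBlDr ltrDl.
Qed.

Lemma scaled_gl_tr {R : realType} {n : nat} (X : 'M[R]_n) :
  scaled_gl X -> scaled_gl X^T.
Proof.
move=> SX e /SX[t [t0 [D uD DX]]]; exists t; split=> //; exists D^T; first by rewrite unitmx_tr.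
apply: le_lt_trans DX; apply: mx_norm_le => // i j.
by rewrite -map_trmx -linearZ/= -linearB/= mxE mx_entry_le.
Qed.

(* The witness is the unipotent integer matrix [1 + floor (tau X)]. *)
Lemma scaled_gl_strict_lower {R : realType} {n : nat} (X : 'M[R]_n) :
  (forall i j : 'I_n, (i <= j)%N -> X i j = 0) -> scaled_gl X.
Proof.
move=> X0 e e0; exists (3 / e); have t0 : 0 < 3 / e by rewrite divr_gt0.
split=> //; set t := 3 / e.
exists (1%:M + \matrix_(i, j) Num.floor (t * X i j)).
  rewrite unitmxE det_trig.
    rewrite big1 ?unitr1// => i _.
    by rewrite !mxE eqxx X0// mulr0 floor0 addr0.
  apply/is_trig_mxP => i j ij; rewrite !mxE X0 1?ltnW// mulr0 floor0 addr0.
  by case: eqP ij => // ->; rewrite ltnn.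
apply: mx_norm_lt => // i j; rewrite !mxE.
rewrite [X in _ - X](_ : _ = t^-1 * (t * X i j)); last by rewrite mulKf ?gt_eqF.
rewrite -mulrBr normrM gtr0_norm ?invr_gt0// mulrC ltr_pdivrMr//.
have -> : e * t = 3 by rewrite /t mulrC divfK ?gt_eqF.
rewrite rmorphD/=.
have := floor_le (t * X i j); have := floorD1_gt (t * X i j).
rewrite rmorphD/=; set f := (Num.floor _)%:~R => h1 h2.
case: (i == j) => /=; rewrite ltr_norml; apply/andP; split. all: lra.
Qed.

Definition corner {R : realType} {d : nat} (X : 'M[R]_d) : 'M[R]_(1 + d) := block_mx 0 0 0 X.

Lemma corner_mul {R : realType} {d : nat} (X Y : 'M[R]_d) :
  corner (X *m Y) = corner X *m corner Y.
Proof. by rewrite /corner mulmx_block !mul0mx !mulmx0 !addr0 !add0r. Qed.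

(** Since the first row and column of [corner T] vanish, moving its columns cyclically one place to
    the left pushes the diagonal of [T] below the main diagonal and gives a strictly lower
    triangular matrix. An integer permutation matrix undoes the shift. *)
Lemma scaled_gl_corner_lower {R : realType} {d : nat} (T : 'M[R]_d) :
  (forall i j : 'I_d, (i < j)%N -> T i j = 0) -> scaled_gl (corner T).
Proof.
move=> T0; pose s : 'S_(1 + d) := perm (@ordS_inj (1 + d)).
pose X := corner T *m perm_mx s^-1.
have -> : corner T = X *m perm_mx s.
  by rewrite /X -mulmxA -perm_mxM mulVg perm_mx1 mulmx1.
apply: scaled_gl_mul; last by rewrite -(map_perm_mx intr); apply: scaled_gl_unit; rewrite unitmx_perm.
apply: scaled_gl_strict_lower => i j.
rewrite /X -col_permE mxE permE.
rewrite /corner; case: (split_ordP (ordS j)) => [j'|j'] e; rewrite e;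
  case: (split_ordP i) => [i'|i'] ->;
  rewrite ?(block_mxEul, block_mxEur, block_mxEdl, block_mxEdr) ?mxE//=.
rewrite add1n => ij.
apply: T0; move/(congr1 val): e; have := ltn_ord j; move: ij => /=.
move: (nat_of_ord j) => k; rewrite add1n => ik.
rewrite ltnS leq_eqVlt => /orP[/eqP ->|kd]; first by rewrite modnn.
by rewrite modn_small// add1n => -[<-].
Qed.

Lemma corner_tr {R : realType} {d : nat} (X : 'M[R]_d) : (corner X)^T = corner X^T.
Proof. by rewrite /corner tr_block_mx !trmx0. Qed.

(** An LUP decomposition reduces to a permutation, a lower and an upper triangular factor; the upper
    one is treated by transposition. *)
Lemma scaled_gl_corner {R : realType} {d : nat} (X : 'M[R]_d) : scaled_gl (corner X).
Proof.
case: d X => [|d] X; first by apply: scaled_gl_corner_lower => -[].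
have := cormen_lup_correct X; have := cormen_lup_perm X.
have := cormen_lup_lower X; have := cormen_lup_upper X.
case: (cormen_lup X) => [[P L] U] /= Uu Ll /is_perm_mxP[s ->] eq.
have -> : X = perm_mx s^-1 *m L *m U.
  move: eq; rewrite -[_ * X]/(_ *m X) -[L * U]/(L *m U) => eq.
  by rewrite -mulmxA -eq mulmxA -perm_mxM mulVg perm_mx1 mul1mx.
rewrite corner_mul; apply: scaled_gl_mul; last first.
  by rewrite -[U]trmxK -corner_tr; apply/scaled_gl_tr/scaled_gl_corner_lower => i j ij; rewrite mxE Uu.
(* A 1 in the top left entry makes the permutation block invertible over the integers; the product
   is unchanged because the first row of [corner L] vanishes. *)
pose Q : 'M[int]_(1 + d.+1) := block_mx 1 0 0 (perm_mx s^-1).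
have -> : corner (perm_mx s^-1 *m L) = zmx Q *m corner L.
  rewrite /Q (map_block_mx intr) map_perm_mx !map_mx0 /corner mulmx_block.
  by rewrite !mul0mx !mulmx0 !addr0 !add0r.
apply: scaled_gl_mul; last first.
  by apply: scaled_gl_corner_lower => i j ij; rewrite Ll ?(ltnW ij)//; case: eqP ij => // ->; rewrite ltnn.
by apply: scaled_gl_unit; rewrite unitmxE det_ublock det1 mul1r -unitmxE unitmx_perm.
Qed.

(** * Steering a lattice to a target *)

Lemma det_continuous {R : realType} {n : nat} : continuous (fun A : 'M[R]_n => \det A).
Proof.
move=> A; rewrite /determinant.
pose sum_cvg := @cvg_big R _ +%R 0 xpredT (@add_continuous R) _ (nbhs A) (index_enum _)
  (fun (s : 'S_n) (A : 'M[R]_n) => (-1) ^+ s * \prod_i A i (s i))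
  (fun s : 'S_n => (-1) ^+ s * \prod_i A i (s i)).
apply: sum_cvg => s _; apply: cvgM; first exact: cvg_cst.
pose prod_cvg := @cvg_big R _ *%R 1 xpredT (@mul_continuous R) _ (nbhs A) (index_enum _)
  (fun (i : 'I_n) (A : 'M[R]_n) => A i (s i)) (fun i => A i (s i)).
by apply: prod_cvg => i _; exact: coord_continuous.
Qed.

Lemma det_close {R : realType} {n : nat} (A : 'M[R]_n) (e : R) : 0 < e ->
  exists2 r : R, 0 < r & forall B, `|B - A| < r -> `|\det B - \det A| < e.
Proof.
move=> e0; have /cvgrPdist_lt/(_ _ e0) := @det_continuous R n A.
move=> /nbhs_ballP[r r0 Hr]; exists r => // B BA.
rewrite distrC; apply: Hr; rewrite -ball_normE/=.
by rewrite distrC.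
Qed.

(** From h - h0 = h (k0 - k) h0; the unknown |h| on the right is absorbed, as |h| <= 2 |h0| once c
    |k - k0| <= 1/2. This transfers nearness from inverses, where steering is computed, back to the
    matrices. *)
Lemma inv_close {R : realType} {n : nat} (h0 k0 : 'M[R]_n) (eta : R) :
  h0 *m k0 = 1%:M -> 0 < eta ->
  exists2 e : R, 0 < e & forall h k, h *m k = 1%:M -> `|k - k0| < e -> `|h - h0| < eta.
Proof.
move=> hk0 eta0; have kh0 : k0 *m h0 = 1%:M by exact: mulmx1C.
pose c : R := n%:R * n%:R * `|h0| + 1.
have c0 : 0 < c by rewrite ltr_wpDl// !mulr_ge0.
pose q : R := 2 * c * (`|h0| + 1).
have q0 : 0 < q by rewrite !mulr_gt0// ltr_wpDl.
exists (Num.min (2 * c)^-1 (eta / q)).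
  by rewrite lt_min divr_gt0// invr_gt0 mulr_gt0.
move=> h k hk; rewrite lt_min => /andP[k1 k2].
have E : h - h0 = h *m (k0 - k) *m h0.
  by rewrite mulmxBr mulmxBl -mulmxA kh0 mulmx1 hk mul1mx.
have le1 : `|h - h0| <= c * `|k - k0| * `|h|.
  rewrite E (le_trans (mx_norm_mul _ _))//.
  apply: (@le_trans _ _ (n%:R * (n%:R * `|h| * `|k0 - k|) * `|h0|)).
    by rewrite ler_wpM2r// ler_wpM2l// mx_norm_mul.
  rewrite distrC [leLHS](_ : _ = (n%:R * n%:R * `|h0|) * (`|k - k0| * `|h|)); last by ring.
  by rewrite -[leRHS]mulrA ler_wpM2r ?mulr_ge0// lerDl.
have ck : c * `|k - k0| <= 2^-1.
  rewrite -ler_pdivlMl// (le_trans (ltW k1))// invfM mulrC.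
  by [].
have hh : `|h| <= 2 * `|h0|.
  have : `|h| <= `|h0| + `|h - h0| by rewrite -{1}(subrK h0 h) addrC ler_normD.
  have : c * `|k - k0| * `|h| <= 2^-1 * `|h| by rewrite ler_wpM2r.
  lra.
apply: le_lt_trans le1 _.
apply: (@le_lt_trans _ _ (c * `|k - k0| * (2 * `|h0|))); first by rewrite ler_wpM2l// mulr_ge0// ltW.
have : `|k - k0| * q < eta by rewrite -ltr_pdivlMr.
rewrite /q; have : 0 <= `|k - k0| * (2 * c) by rewrite !mulr_ge0// ltW.
rewrite (_ : `|k - k0| * (2 * c * (`|h0| + 1)) =
  c * `|k - k0| * (2 * `|h0|) + `|k - k0| * (2 * c)); last by ring.
lra.
Qed.

(** The rows of [horo alpha B] span the lattice of points (k, k alpha + l), with k an integer and l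
    in the lattice of [B]; for t > 1, [flow] squeezes k and stretches the other coordinates. *)
Definition horo {R : realType} {d : nat} (b : 'rV[R]_d) (D : 'M[R]_d) : 'M[R]_(1 + d) :=
  block_mx 1%:M b 0 D.

Definition flow {R : realType} (d : nat) (t : R) : 'M[R]_(1 + d) :=
  block_mx (t ^- d)%:M 0 0 t%:M.

Lemma det_horo {R : realType} {d : nat} (b : 'rV[R]_d) D : \det (horo b D) = \det D.
Proof. by rewrite /horo det_ublock det1 mul1r. Qed.

Lemma det_flow {R : realType} (d : nat) (t : R) : t != 0 -> \det (flow d t) = 1.
Proof. by move=> t0; rewrite /flow det_ublock !det_scalar expr1 mulVf// expf_neq0. Qed.

Lemma horoD {R : realType} {d : nat} (b c : 'rV[R]_d) D : horo b 1%:M *m horo c D = horo (c + b *m D) D.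
Proof. by rewrite /horo mulmx_block !mul1mx !mulmx0 !mul0mx !addr0 ?add0r. Qed.

Lemma det_zmx {R : realType} {n : nat} (D : 'M[int]_n) :
  D \in unitmx -> `|\det (zmx D : 'M[R]_n)| = 1.
Proof.
rewrite unitmxE det_map_mx -intr_norm => /orP[] /eqP ->; first by rewrite normr1.
by rewrite normrN1.
Qed.

Lemma det_block_row {R : realType} {d : nat} (mu : 'M[R]_1) (p : 'rV[R]_d) w D :
  \det (block_mx mu p w D) = mu 0 0 * \det D + \det (block_mx 0 p w D).
Proof.
rewrite (@determinant_multilinear _ _ _ (block_mx 1%:M 0 w D) (block_mx 0 p w D) (lshift d ord0) (mu 0 0) 1).
- by rewrite det_lblock det1 !mul1r.
- apply/rowP => j; rewrite !mxE; case: splitP => //= i; rewrite ord1 => _; rewrite !mxE.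
  case: splitP => j' _; rewrite !mxE; first by rewrite !ord1 mulr1 mulr0 addr0.
  by rewrite mulr0 mul1r add0r.
- apply/matrixP => i j; rewrite !mxE; case: splitP => //= k Hk.
  by exfalso; move: Hk; rewrite ord1.
- apply/matrixP => i j; rewrite !mxE; case: splitP => //= k Hk.
  by exfalso; move: Hk; rewrite ord1.
Qed.

(** The determinant is affine in the corner entry: [mu 0 0] times det D plus a determinant that
    vanishes for w = 0. As |det D| is close to 1, so is |mu|, while its sign stays free. *)
Lemma sign_close {R : realType} {d : nat} (p : 'rV[R]_d) (D0 : 'M[R]_d) (e : R) :
  `|\det D0| = 1 -> 0 < e -> exists2 r : R, 0 < r &
  forall w D, `|w| < r -> `|D - D0| < r -> D \in unitmx /\
    forall mu, `|\det (block_mx mu p w D)| = 1 -> `| `|mu 0 0| - 1 | < e.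
Proof.
move=> D01 e0; pose e1 : R := Num.min (1/2) (e / 8).
have e10 : 0 < e1 by rewrite lt_min !divr_gt0.
have [e12 e1e] : e1 <= 1 / 2 /\ e1 <= e / 8 by rewrite /e1; split; rewrite ge_min lexx ?orbT.
have [r1 r10 H1] := det_close D0 _ e10.
have [r2 r20 H2] := det_close (block_mx 0 p 0 D0) _ e10.
exists (Num.min r1 r2); first by rewrite lt_min r10.
move=> w D; rewrite !lt_min => /andP[_ wr] /andP[/H1 Dr Dr2].
have /H2 : `|block_mx 0 p w D - block_mx 0 p 0 D0| < r2.
  rewrite opp_block_mx add_block_mx !subrr !subr0; apply: mx_norm_lt => // i j.
  case: (split_ordP i) => i' ->; case: (split_ordP j) => j' ->;
    rewrite ?(block_mxEul, block_mxEur, block_mxEdl, block_mxEdr) ?mxE ?normr0//.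
    exact: le_lt_trans (mx_entry_le _ _ _) wr.
  by apply: le_lt_trans Dr2; have := mx_entry_le (D - D0) i' j'; rewrite !mxE.
rewrite det_ublock det_mx11 mxE mul0r subr0.
set z := \det _; set q := \det D in Dr * => zr.
have q_lo : 1 - e1 < `|q|.
  by have := lerB_dist (\det D0) q; rewrite D01 distrC; lra.
have q_hi : `|q| < 1 + e1.
  by have := ler_normD (q - \det D0) (\det D0); rewrite subrK D01; lra.
split; first by rewrite unitmxE unitfE -normr_gt0 -/q; lra.
move=> mu; rewrite det_block_row -/z -/q; set m := mu 0 0 => dM.
have mq_lo : 1 - e1 < `|m| * `|q|.
  by have := ler_normD (m * q) z; rewrite dM normrM; lra.
have mq_hi : `|m| * `|q| < 1 + e1.
  by have := lerB_normD (m * q) z; rewrite dM normrM; lra.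
have m0 : 0 <= `|m| by [].
rewrite ltr_norml; apply/andP; split; rewrite ltNge; apply/negP => hm; nra.
Qed.

Lemma mx_norm_block_lt {R : realType} {m1 m2 n1 n2 : nat} (A : 'M[R]_(m1, n1))
    (B : 'M[R]_(m1, n2)) (C : 'M[R]_(m2, n1)) (D : 'M[R]_(m2, n2)) (e : R) :
  `|A| < e -> `|B| < e -> `|C| < e -> `|D| < e -> `|block_mx A B C D| < e.
Proof.
move=> Ae Be Ce De; apply: mx_norm_lt => [|i j]; first exact: le_lt_trans Ae.
case: (split_ordP i) => i' ->; case: (split_ordP j) => j' ->;
  rewrite ?(block_mxEul, block_mxEur, block_mxEdl, block_mxEdr).
- exact: le_lt_trans (mx_entry_le _ _ _) Ae.
- exact: le_lt_trans (mx_entry_le _ _ _) Be.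
- exact: le_lt_trans (mx_entry_le _ _ _) Ce.
- exact: le_lt_trans (mx_entry_le _ _ _) De.
Qed.

(* On inverses: [W], the last rows of the inverse of [g], satisfies [W *m corner (V *m invmx D) = (0, D^-1)],
   so a rescaled integer matrix near this corner moves [W] where it should go; [b] then adjusts the
   first row except for its first entry, which is [1] or [-1] up to a small error because of the
   determinant. *)
Lemma steer_lower {R : realType} {d : nat} (a : 'M[R]_1) c (V D : 'M[R]_d) (y : 'rV[R]_d)
    (eta : R) :
  `|\det (block_mx a 0 c V)| = 1 -> `|\det D| = 1 -> 0 < eta ->
  exists tau : R, 0 < tau /\ exists b : 'rV[R]_d, exists2 G : 'M[int]_(1 + d), G \in unitmx &
    `|zmx G *m block_mx a 0 c V *m horo b 1%:M *m flow d tau - horo y D| < eta.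
Proof.
move=> dg dD eta0; set g := block_mx a 0 c V.
have uD : D \in unitmx by rewrite unitmxE unitfE -normr_gt0 dD.
have ug : g \in unitmx by rewrite unitmxE unitfE -normr_gt0 dg.
have uV : V \in unitmx.
  move: dg; rewrite det_lblock normrM => e1; rewrite unitmxE unitfE; apply/eqP => V0.
  by move: e1; rewrite V0 normr0 mulr0 => /esym/eqP; rewrite oner_eq0.
pose p : 'rV[R]_d := - (y *m invmx D); pose k0 : 'M[R]_(1 + d) := block_mx 1%:M p 0 (invmx D).
have hk0 : horo y D *m k0 = 1%:M.
  rewrite /horo /k0 mulmx_block !mul1mx !mulmx0 !mul0mx !addr0 add0r mulmxV// /p addNr.
  by rewrite -scalar_mx_block.
have [e e0 He] := inv_close _ _ _ hk0 eta0.
have dDi : `|\det (invmx D)| = 1 by rewrite det_inv normfV dD invr1.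
have [r r0 Hr] := sign_close p (invmx D) e dDi e0.
pose W := dsubmx (invmx g).
have Wg : W *m g = row_mx 0 1%:M.
  rewrite /W mul_dsub_mx mulVmx// (scalar_mx_block 1 d 1) /block_mx col_mxKd.
  by [].
have WX : W *m corner (V *m invmx D) = row_mx 0 (invmx D).
  rewrite -[W]hsubmxK /corner mul_row_block !mulmx0 !addr0 add0r mulmxA.
  move: Wg; rewrite -{1}[W]hsubmxK /g mul_row_block mulmx0 add0r => /eq_row_mx[_ ->].
  by rewrite mul1mx.
pose r' := Num.min r e; have r'0 : 0 < r' by rewrite lt_min r0.
pose q : R := (1 + d)%:R * `|W| + 1; have q0 : 0 < q by rewrite ltr_wpDl// mulr_ge0.
have [t [t0 [dl udl Hdl]]] := scaled_gl_corner (V *m invmx D) _ (divr_gt0 r'0 q0).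
pose Z := t^-1 *: (W *m zmx dl).
have Zr : `|Z - row_mx 0 (invmx D)| < r'.
  rewrite -WX /Z scalemxAr -mulmxBr (le_lt_trans (mx_norm_mul _ _))//.
  apply: (@le_lt_trans _ _ ((1 + d)%:R * `|W| * (r' / q))); first by rewrite ler_wpM2l ?mulr_ge0// ltW.
  by rewrite mulrCA gtr_pMr// ltr_pdivrMr// mul1r /q ltrDl.
have wr : `|lsubmx Z| < r'.
  apply: mx_norm_lt => // i j; apply: le_lt_trans Zr; rewrite -[Z in leRHS]hsubmxK.
  rewrite opp_row_mx add_row_mx subr0.
  by have := mx_entry_le (row_mx (lsubmx Z) (rsubmx Z - invmx D)) i (lshift d j); rewrite row_mxEl.
have Dr : `|rsubmx Z - invmx D| < r'.
  apply: mx_norm_lt => // i j; apply: le_lt_trans Zr; rewrite -[Z in leRHS]hsubmxK.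
  rewrite opp_row_mx add_row_mx subr0.
  by have := mx_entry_le (row_mx (lsubmx Z) (rsubmx Z - invmx D)) i (rshift 1 j); rewrite row_mxEr.
set w := lsubmx Z in wr; set D' := rsubmx Z in Dr.
move: wr Dr; rewrite !lt_min => /andP[wr we] /andP[Dr De].
have [uD' Hmu] := Hr _ _ wr Dr.
pose f := usubmx (invmx g) *m zmx dl.
(* Solves t^d f - t^(d+1) b D' = p in the last d coordinates, so that the upper right block of [k],
   the inverse of [h], is exactly [p]. *)
pose b : 'rV[R]_d := t ^- d.+1 *: ((t ^+ d *: rsubmx f - p) *m invmx D').
pose k : 'M[R]_(1 + d) := block_mx (t ^+ d)%:M 0 0 (t^-1)%:M *m horo (- b) 1%:M *m invmx g *m zmx dl.
pose h := zmx (invmx dl) *m g *m horo b 1%:M *m flow d t.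
have hk : h *m k = 1%:M.
  rewrite /h /k !mulmxA -[_ *m flow d t *m _]mulmxA.
  have -> : flow d t *m block_mx (t ^+ d)%:M 0 0 (t^-1)%:M = 1%:M.
    rewrite /flow mulmx_block !mulmx0 !mul0mx !addr0 add0r -!scalar_mxM.
    by rewrite mulVf ?expf_neq0 ?gt_eqF// divff ?gt_eqF// -scalar_mx_block.
  rewrite mulmx1 -[_ *m horo b _ *m _]mulmxA horoD mulmx1 addNr.
  rewrite /horo -scalar_mx_block mulmx1 -[_ *m g *m _]mulmxA mulmxV// mulmx1.
  by rewrite -map_mxM mulVmx// map_mx1.
have kE : k = block_mx (t ^+ d *: lsubmx f - t ^+ d.+1 *: (b *m w)) p w D'.
  rewrite /k -[invmx g]vsubmxK -/W /horo mulmx_block !mulmx0 !mul0mx mulmx1 !addr0 !add0r.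
  rewrite mul_block_col mul0mx add0r mulmx1 mul_col_mx mulmxDl -!mulmxA -/f.
  rewrite mul_scalar_mx [_%:M *m (- b *m _)]mul_scalar_mx [_%:M *m (W *m _)]mul_scalar_mx -/Z.
  rewrite /block_mx; congr col_mx; last by rewrite hsubmxK.
  have -> : W *m zmx dl = t *: Z by rewrite /Z scalerA divff ?scale1r ?gt_eqF.
  rewrite -scalemxAr scalerA -exprSr -[Z]hsubmxK -/w -/D' mul_mx_row -[f in LHS]hsubmxK.
  rewrite !scale_row_mx add_row_mx !mulNmx !scalerN; congr row_mx.
  rewrite /b -scalemxAl mulmxKV// scalerA divff ?expf_neq0 ?gt_eqF// scale1r.
  by rewrite opprB addrC subrK.
have dh : `|\det h| = 1.
  rewrite /h !det_mulmx !normrM det_zmx ?unitmx_inv// dg det_horo det1 normr1 det_flow ?gt_eqF//.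
  by rewrite normr1 !mulr1.
have dk : `|\det k| = 1.
  by have := congr1 (Num.norm \o determinant) hk; rewrite /= det_mulmx normrM dh mul1r det1 normr1.
set mu := _ - _ in kE.
have {}Hmu := Hmu mu; rewrite -kE in Hmu; have {}Hmu := Hmu dk.
clearbody mu.
(* [sign_close] controls only the absolute value of [mu]. The integer involution [Sg] flips the
   first column of [k], hence the first row of [h], when [mu] is negative. *)
pose s : int := if mu 0 0 < 0 then -1 else 1.
have ss : s * s = 1 by rewrite /s; case: ifP => _; rewrite ?mulr1 ?mulrNN ?mulr1.
pose Sg : 'M[int]_(1 + d) := block_mx s%:M 0 0 1%:M.
have SS : Sg *m Sg = 1%:M.
  by rewrite /Sg mulmx_block !mulmx0 !mul0mx !addr0 add0r mulmx1 -scalar_mxM ss -scalar_mx_block.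
exists t; split=> //; exists b; exists (Sg *m invmx dl).
  by rewrite unitmx_mul unitmx_inv udl andbT; case/mulmx1_unit : SS.
have -> : zmx (Sg *m invmx dl) *m g *m horo b 1%:M *m flow d t = zmx Sg *m h.
  by rewrite map_mxM /h !mulmxA.
apply: (He _ (k *m zmx Sg)).
  by rewrite -mulmxA (mulmxA h) hk mul1mx -map_mxM SS map_mx1.
have -> : k *m zmx Sg = block_mx ((s%:~R : R) *: mu) p ((s%:~R : R) *: w) D'.
  rewrite kE /Sg (map_block_mx intr) !map_mx0 map_mx1 map_scalar_mx mulmx_block.
  by rewrite !mulmx0 !mulmx1 !addr0 !add0r !mul_mx_scalar.
rewrite /k0 opp_block_mx add_block_mx subrr subr0.
have ns : `|s%:~R : R| = 1 by rewrite /s; case: ifP => _; rewrite ?normrN1 ?normr1.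
apply: mx_norm_block_lt; rewrite ?normr0// ?subr0 ?mx_normZ ?ns ?mul1r//.
apply: mx_norm_lt => // i j; rewrite !ord1 !mxE eqxx; move: Hmu; rewrite /s.
case: (ltP (mu 0 0) 0) => m0; last by rewrite (ger0_norm m0) mulr1z mul1r.
by rewrite (ltr0_norm m0) mulrN1z mulN1r.
Qed.

(** An integer row exchange makes the top left entry nonzero, and a first move [b0] then clears the
    rest of the first row; moves add up, so [steer_lower] applies. *)
Lemma steer {R : realType} {d : nat} (g : 'M[R]_(1 + d)) (D : 'M[R]_d) (y : 'rV[R]_d)
    (eta : R) :
  `|\det g| = 1 -> `|\det D| = 1 -> 0 < eta ->
  exists tau : R, 0 < tau /\ exists b : 'rV[R]_d, exists2 G : 'M[int]_(1 + d), G \in unitmx &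
    `|zmx G *m g *m horo b 1%:M *m flow d tau - horo y D| < eta.
Proof.
move=> dg dD eta0.
have [i gi] : exists i, g i (lshift d 0) != 0.
  apply: contrapT => /forallNP g0.
  have : \det g = 0.
    rewrite (expand_det_col _ (lshift d 0)) big1// => i _.
    by have /negP := g0 i; rewrite negbK => /eqP ->; rewrite mul0r.
  by move=> e; move: dg; rewrite e normr0 => /esym/eqP; rewrite oner_eq0.
pose P : 'M[int]_(1 + d) := perm_mx (tperm (lshift d 0) i).
have uP : P \in unitmx by rewrite unitmx_perm.
pose g' := zmx P *m g.
have g'0 : ulsubmx g' 0 0 != 0 by rewrite /g' /P map_perm_mx -row_permE !mxE tpermL.
pose b0 : 'rV[R]_d := - (ulsubmx g' 0 0)^-1 *: ursubmx g'.
have g'E : g' *m horo b0 1%:M = block_mx (ulsubmx g') 0 (dlsubmx g') (dlsubmx g' *m b0 + drsubmx g').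
  rewrite -{1}[g']submxK /horo mulmx_block !mulmx1 !mulmx0 !addr0; congr (block_mx _ _ _ _).
  rewrite [ulsubmx g' in LHS]mx11_scalar mul_scalar_mx /b0 scalerA mulrN divff// scaleN1r.
  by rewrite addNr.
have dg' : `|\det (g' *m horo b0 1%:M)| = 1.
  by rewrite /g' !det_mulmx !normrM det_zmx// dg det_horo det1 normr1 !mulr1.
rewrite g'E in dg'.
have [t [t0 [b [G uG HG]]]] := steer_lower _ _ _ D y eta dg' dD eta0.
exists t; split=> //; exists (b + b0); exists (G *m P); first by rewrite unitmx_mul uG.
apply: le_lt_trans HG; rewrite -g'E /g' map_mxM -!mulmxA.
by rewrite (mulmxA (horo b0 _)) horoD mulmx1 !mulmxA.
Qed.

(** * Bounded bases *)

Lemma round_multiple {R : realType} (a x : R) : a != 0 ->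
  exists k : int, `|k%:~R * a + x| <= `|a| / 2.
Proof.
move=> a0; exists (- Num.floor (x / a + 1 / 2)).
have := floor_le (x / a + 1 / 2); have := floorD1_gt (x / a + 1 / 2).
rewrite rmorphD rmorphN/=; set f := (Num.floor _)%:~R => h1 h2.
have -> : - f * a + x = (x / a - f) * a by rewrite mulrBl divfK// mulNr addrC.
rewrite normrM mulrC ler_wpM2l// ler_norml; apply/andP; split; lra.
Qed.

Lemma mx_norm_perm {R : realType} {m n : nat} (A : 'M[R]_(m, n)) (s : 'S_n) :
  `|A *m perm_mx s| = `|A|.
Proof.
suff le (B : 'M[R]_(m, n)) (u : 'S_n) : `|B *m perm_mx u| <= `|B|.
  apply/eqP; rewrite eq_le le /=.
  have {1}-> : A = A *m perm_mx s *m perm_mx s^-1.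
    by rewrite -mulmxA -perm_mxM mulgV perm_mx1 mulmx1.
  exact: le.
apply: mx_norm_le => // i j; rewrite -[u]invgK -col_permE mxE; exact: mx_entry_le.
Qed.

Lemma mx_norm_block_le {R : realType} {m1 m2 n1 n2 : nat} (A : 'M[R]_(m1, n1))
    (B : 'M[R]_(m1, n2)) (C : 'M[R]_(m2, n1)) (D : 'M[R]_(m2, n2)) (e : R) :
  `|A| <= e -> `|B| <= e -> `|C| <= e -> `|D| <= e -> `|block_mx A B C D| <= e.
Proof.
move=> Ae Be Ce De; apply: mx_norm_le => [|i j]; first exact: le_trans Ae.
case: (split_ordP i) => i' ->; case: (split_ordP j) => j' ->;
  rewrite ?(block_mxEul, block_mxEur, block_mxEdl, block_mxEdr).
- exact: le_trans (mx_entry_le _ _ _) Ae.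
- exact: le_trans (mx_entry_le _ _ _) Be.
- exact: le_trans (mx_entry_le _ _ _) Ce.
- exact: le_trans (mx_entry_le _ _ _) De.
Qed.

Lemma mx_norm_row_le {R : realType} {m n1 n2 : nat} (A : 'M[R]_(m, n1))
    (B : 'M[R]_(m, n2)) (e : R) : `|A| <= e -> `|B| <= e -> `|row_mx A B| <= e.
Proof.
move=> Ae Be; apply: mx_norm_le => [|i j]; first exact: le_trans Ae.
case: (split_ordP j) => j' ->; rewrite ?(row_mxEl, row_mxEr).
  exact: le_trans (mx_entry_le _ _ _) Ae.
exact: le_trans (mx_entry_le _ _ _) Be.
Qed.

(** Smith normal form of a one-row matrix: row 0 of [G] is the primitive vector underlying [m],
    completed to a basis of Z^(1+n). *)
Lemma unimodular_completion {n : nat} (m : 'rV[int]_(1 + n)) : m != 0 ->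
  exists2 G : 'M[int]_(1 + n), G \in unitmx & exists2 z : int, z != 0 & m = z *: row 0 G.
Proof.
move=> m0; have [L _ [G uG [s _ mE]]] := int_Smith_normal_form m.
exists G => //; exists (L 0 0 * s`_0).
  apply: contraNneq m0 => z0; apply/eqP; rewrite mE; apply/rowP => j.
  rewrite !mxE big1// => k _; rewrite !mxE (big_ord1) !mxE; case: eqP => [_|_].
    by rewrite mulr1n z0 mul0r.
  by rewrite mulr0n mulr0 mul0r.
rewrite {1}mE; apply/rowP => j; rewrite !mxE (bigD1 0)//= big1 ?addr0.
  by rewrite !mxE big_ord1 !mxE eqxx mulr1n.
move=> k k0; rewrite !mxE big_ord1 !mxE; case: eqP => [e|_].
  by case/eqP: k0; apply: val_inj.
by rewrite mulr0n mulr0 mul0r.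
Qed.

(** The infimum of the norms need not be shown to be attained: a vector within a factor 5/4 of it is
    enough, and dividing out its content, which never lengthens it, yields the first row of a
    unimodular matrix. *)
Lemma short_basis_vector {R : realType} {n : nat} (g : 'M[R]_(1 + n)) (eps : R) :
  0 < eps -> (forall m : 'rV[int]_(1 + n), m != 0 -> eps <= `|zmx m *m g|) ->
  exists2 lam : R, eps <= lam & (forall m : 'rV[int]_(1 + n), m != 0 -> lam <= `|zmx m *m g|) /\
  exists2 G : 'M[int]_(1 + n), G \in unitmx & `|row 0 (zmx G *m g)| <= 5 / 4 * lam.
Proof.
move=> eps0 Hg; pose S : set R := [set r | exists2 m : 'rV[int]_(1 + n), m != 0 & r = `|zmx m *m g|].
have S0 : S !=set0.
  pose m : 'rV[int]_(1 + n) := delta_mx 0 0; exists `|zmx m *m g|; exists m => //.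
  by apply/eqP => /matrixP/(_ 0 0); rewrite !mxE eqxx.
have lbS : lbound S eps by move=> _ [m m0 ->]; exact: Hg.
have hS : has_inf S by split=> //; exists eps.
have epsS : eps <= inf S by exact: lb_le_inf.
exists (inf S) => //; split.
  by move=> m m0; apply: ge_inf; [exists eps|exists m].
have [_ [m m0 ->] Hm] : exists2 r, S r & r < inf S + 1 / 4 * inf S.
  by apply: inf_adherent => //; rewrite mulr_gt0// ?(lt_le_trans eps0)// divr_gt0.
have [G uG [z z0 mE]] := unimodular_completion _ m0.
exists G => //; rewrite row_mul; apply: (@le_trans _ _ `|zmx m *m g|); last by lra.
rewrite mE map_mxZ/= -scalemxAl mx_normZ -map_row ler_peMl//.
by rewrite -intr_norm ler1z -gtz0_ge1 normr_gt0.
Qed.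

Lemma mx_norm11 {R : realType} (a : 'M[R]_1) : `|a| = `|a 0 0|.
Proof.
apply/eqP; rewrite eq_le mx_entry_le andbT.
by apply: mx_norm_le => // i j; rewrite !ord1.
Qed.

(* If the first row [(a, p)] of [g] is a shortest vector up to the factor 5/4 and [a] is its largest
   entry, then projecting along it keeps vectors long: a vector of the projected lattice lifts to one
   whose first coordinate is at most [|a| / 2]. *)
Lemma projected_lattice {R : realType} {n : nat} (a : 'M[R]_1) (p : 'rV[R]_n) c V (lam : R) :
  0 < lam -> `|p| <= `|a| -> `|a| <= 5 / 4 * lam ->
  (forall m : 'rV[int]_(1 + n), m != 0 -> lam <= `|zmx m *m block_mx a p c V|) ->
  a 0 0 != 0 /\ forall m : 'rV[int]_n, m != 0 ->
    3 / 8 * lam <= `|zmx m *m (V - (a 0 0)^-1 *: (c *m p))|.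
Proof.
move=> lam0 pa a5 Hg.
have a0 : a 0 0 != 0.
  rewrite -normr_gt0 -mx_norm11 lt_neqAle normr_ge0 andbT eq_sym; apply/eqP => a0.
  pose m : 'rV[int]_(1 + n) := row_mx 1%:M 0.
  have /Hg : m != 0.
    by apply/eqP => /matrixP/(_ 0 (lshift n 0)); rewrite row_mxEl !mxE eqxx.
  rewrite (map_row_mx intr) map_mx1 map_mx0 mul_row_block !mul1mx !mul0mx !addr0.
  by move=> /le_trans/(_ (mx_norm_row_le _ _ 0 _ _)); rewrite -a0 pa lexx => /(_ isT isT); rewrite a0 leNgt lam0.
split=> // m m0.
have [k Hk] := round_multiple (a 0 0) ((zmx m *m c) 0 0) a0.
pose m' : 'rV[int]_(1 + n) := row_mx k%:M m.
have /Hg : m' != 0 by apply: contraNneq m0 => m'0; rewrite -[m](row_mxKr k%:M) -/m' m'0; apply/eqP/matrixP => i j; rewrite !mxE.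
rewrite (map_row_mx intr) map_scalar_mx mul_row_block !mul_scalar_mx.
set x := _ + zmx m *m c; set v := zmx m *m (V - _) => Hl.
have xE : x = (k%:~R * a 0 0 + (zmx m *m c) 0 0)%:M.
  by rewrite [x]mx11_scalar; congr (_%:M); rewrite /x [LHS]mxE [X in X + _]mxE.
have vE : k%:~R *: p + zmx m *m V = v + ((a 0 0)^-1 * (k%:~R * a 0 0 + (zmx m *m c) 0 0)) *: p.
  rewrite /v mulmxBr -scalemxAr mulmxA [zmx m *m c]mx11_scalar mul_scalar_mx scalerA.
  rewrite mulrDr [_ * (_ * a 0 0)]mulrCA mulVf// mulr1 scalerDl !mxE eqxx mulr1n.
  by rewrite [in RHS](addrC (k%:~R *: p)) addrA subrK addrC.
set w := _ * a 0 0 + _ in xE vE Hk.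
move: Hl; rewrite vE => Hl.
have nx : `|x| <= `|a| / 2.
  by rewrite xE mx_norm11 !mxE eqxx mulr1n mx_norm11.
have nv : `|v + ((a 0 0)^-1 * w) *: p| <= `|v| + `|a| / 2.
  rewrite (le_trans (ler_normD _ _))// lerD2l mx_normZ normrM normfV.
  rewrite [X in X <= _](_ : _ = `|w| * (`|p| / `|a 0 0|)); last by ring.
  have pa1 : `|p| / `|a 0 0| <= 1 by rewrite ler_pdivrMr ?normr_gt0// mul1r -mx_norm11.
  apply: le_trans (ler_wpM2l (normr_ge0 _) pa1) _; by rewrite mulr1 mx_norm11.
have : lam <= `|v| + `|a| / 2.
  by apply: le_trans Hl (mx_norm_row_le _ _ _ _ nv); rewrite (le_trans nx)// lerDr.
lra.
Qed.

Lemma ulsubmx_row {R : realType} {n : nat} (A : 'M[R]_(1 + n)) :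
  ulsubmx A 0 0 = row 0 A 0 (lshift n 0).
Proof. by rewrite !mxE; congr (A _ _); apply: val_inj. Qed.

Lemma ursubmx_row {R : realType} {n : nat} (A : 'M[R]_(1 + n)) j :
  ursubmx A 0 j = row 0 A 0 (rshift 1 j).
Proof. by rewrite !mxE; congr (A _ _); apply: val_inj. Qed.

Lemma row_unitmx_neq0 {n : nat} (G : 'M[int]_n) i : G \in unitmx -> row i G != 0.
Proof.
apply: contraTneq => r0; rewrite unitmxE (expand_det_row _ i) big1 ?unitr0// => j _.
by have /rowP/(_ j) := r0; rewrite !mxE => ->; rewrite mul0r.
Qed.

Lemma det_mx_size0 {R : comPzRingType} {n : nat} (A : 'M[R]_n) : n = 0%N -> \det A = 1.
Proof. by move=> n0; move: A; rewrite n0 => A; rewrite det_mx00. Qed.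

(** Reduction by induction on the dimension: project along a nearly shortest basis vector, bound a
    basis of the projection and lift it. The projection keeps vectors of norm at least 3/8 eps and
    has determinant det g / a up to sign, at most C0 / eps in size, so the constant depends only on
    n, eps and C0. *)
Lemma bounded_basis {R : realType} (n : nat) (eps C0 : R) : 0 < eps -> 0 <= C0 ->
  exists C : R, forall g : 'M[R]_n, `|\det g| <= C0 ->
    (forall m : 'rV[int]_n, m != 0 -> eps <= `|zmx m *m g|) ->
    exists2 G : 'M[int]_n, G \in unitmx & `|zmx G *m g| <= C.
Proof.
elim: n eps C0 => [|n IHn] eps C0 eps0 C00.
  exists 0 => g _ _; exists 1%:M; rewrite ?unitmx1//.
  by apply: mx_norm_le => // -[].
have [C HC] : exists C : R, forall g : 'M[R]_n, `|\det g| <= C0 / eps ->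
    (forall m : 'rV[int]_n, m != 0 -> 3 / 8 * eps <= `|zmx m *m g|) ->
    exists2 G : 'M[int]_n, G \in unitmx & `|zmx G *m g| <= C.
  by apply: IHn; [rewrite mulr_gt0// divr_gt0|rewrite divr_ge0// ltW].
(* C0 + 4 |C| bounds |a|: for n > 0 a row of the reduced projection shows 3/8 lam <= |C|, while |a|
   <= 5/4 lam; for n = 0 the determinant bounds |a|. The last |C| is for the projected rows. *)
exists (C0 + 4 * `|C| + `|C|) => g dg Hg.
rewrite -[n.+1]/(1 + n)%N in g dg Hg *.
have [lam epslam [Hlam [G0 uG0 HG0]]] := short_basis_vector _ _ eps0 Hg.
have lam0 : 0 < lam := lt_le_trans eps0 epslam.
set b := row 0 _ in HG0.
have b0 : 0 < `|b|.
  apply: lt_le_trans lam0 _; rewrite /b row_mul -map_row; apply: Hlam.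
  exact: row_unitmx_neq0.
have [[i0 i] /= bi] : exists i, mx_norm b = `|b i.1 i.2| by apply: mx_norm_neq0; rewrite gt_eqF.
rewrite ord1 in bi => {i0}.
(* A column permutation, which preserves the sup norm, brings the largest entry of the short vector
   to the front. *)
pose P : 'M[R]_(1 + n) := perm_mx (tperm (lshift n 0) i).
pose g1 : 'M[R]_(1 + n) := zmx G0 *m g *m P.
have g1b : row 0 g1 = b *m P by rewrite row_mul.
pose a := ulsubmx g1; pose p := ursubmx g1; pose c := dlsubmx g1; pose V := drsubmx g1.
have g1E : g1 = block_mx a p c V by rewrite submxK.
have aE : a 0 0 = b 0 i.
  by rewrite /a ulsubmx_row g1b /P -[tperm _ _]invgK -col_permE mxE tpermV tpermL.
have na : `|a| = `|b| by rewrite mx_norm11 aE -bi.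
have pa : `|p| <= `|a|.
  rewrite na -(mx_norm_perm b (tperm (lshift n 0) i)) -/P -g1b.
  apply: mx_norm_le => // k j; rewrite ord1.
  by rewrite /p ursubmx_row; exact: mx_entry_le.
have a5 : `|a| <= 5 / 4 * lam by rewrite na.
have Hg1 (m : 'rV[int]_(1 + n)) : m != 0 -> lam <= `|zmx m *m block_mx a p c V|.
  move=> m0; rewrite -g1E /g1 !mulmxA mx_norm_perm -map_mxM; apply: Hlam.
  by apply: contraNneq m0 => e; rewrite -[m](mulmxK uG0) e mul0mx.
have [a0 HV] := projected_lattice _ _ _ _ _ lam0 pa a5 Hg1.
set V' := V - _ in HV.
have aeps : eps <= `|a|.
  rewrite na (le_trans epslam)// /b row_mul -map_row; apply: Hlam.
  exact: row_unitmx_neq0.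
have dE : `|a| * `|\det V'| <= C0.
  rewrite mx_norm11 -normrM.
  have -> : a 0 0 * \det V' = \det (g1 *m horo (- (a 0 0)^-1 *: p) 1%:M).
    rewrite g1E /horo mulmx_block !mulmx1 !mulmx0 !addr0.
    have -> : a *m (- (a 0 0)^-1 *: p) + p = 0.
      by rewrite {1}(mx11_scalar a) mul_scalar_mx scalerA mulrN divff// scaleN1r addNr.
    by rewrite det_lblock det_mx11 -scalemxAr addrC scaleNr.
  rewrite !det_mulmx !normrM det_horo det1 normr1 mulr1 det_zmx// mul1r det_perm.
  by rewrite normr_sign mulr1.
have dV : `|\det V'| <= C0 / eps.
  rewrite ler_pdivlMr// mulrC (le_trans _ dE)//.
  by rewrite ler_wpM2r.
have [G' uG' HG'] : exists2 G : 'M[int]_n, G \in unitmx & `|zmx G *m V'| <= C.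
  by apply: HC => // m /HV; apply: le_trans; rewrite ler_wpM2l ?divr_ge0.
have aC : `|a| <= C0 + 4 * `|C|.
  have [n0|n0] := posnP n.
    by move: dE; rewrite (det_mx_size0 _ n0) normr1 mulr1 => /le_trans; apply; rewrite lerDl mulr_ge0.
  have : 3 / 8 * lam <= `|C|.
    apply: (@le_trans _ _ `|zmx (row (Ordinal n0) G') *m V'|).
      exact/HV/row_unitmx_neq0.
    apply: le_trans (ler_norm _); apply: le_trans HG'.
    rewrite map_row -row_mul; apply: mx_norm_le => // i' j; rewrite mxE; exact: mx_entry_le.
  lra.
(* Adding multiples of the first basis vector to the lifted rows brings their first coordinates down
   to |a| / 2; the other coordinates then differ from the projected rows by at most |a| / 2, since
   |p| <= |a|. *)
have /choice[K HK] : forall i', exists k : int, `|k%:~R * a 0 0 + (zmx G' *m c) i' 0| <= `|a| / 2.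
  by move=> i'; rewrite mx_norm11; exact: round_multiple.
pose Kc : 'cV[int]_n := \col_(k < n) K k.
exists (block_mx 1%:M 0 Kc G' *m G0).
  by rewrite unitmx_mul uG0 unitmxE det_lblock det1 mul1r -unitmxE uG'.
rewrite -(mx_norm_perm _ (tperm (lshift n 0) i)) -/P map_mxM -!mulmxA (mulmxA _ g) -/g1.
have X2 : `|zmx Kc *m a + zmx G' *m c| <= `|a| / 2.
  apply: mx_norm_le => [|i' j]; first by rewrite divr_ge0.
  rewrite ord1; suff -> : (zmx Kc *m a + zmx G' *m c) i' 0 = (K i')%:~R * a 0 0 + (zmx G' *m c) i' 0 by [].
  by rewrite mxE; congr (_ + _); rewrite mxE big_ord1 !mxE.
rewrite g1E (map_block_mx intr) map_mx1 map_mx0 mulmx_block !mul1mx !mul0mx !addr0.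
have VE : zmx Kc *m p + zmx G' *m V =
    zmx G' *m V' + (zmx Kc *m a + zmx G' *m c) *m ((a 0 0)^-1 *: p).
  have ap : a *m ((a 0 0)^-1 *: p) = p.
    by rewrite {1}(mx11_scalar a) mul_scalar_mx scalerA divff// scale1r.
  rewrite mulmxDl -[_ *m a *m _]mulmxA ap /V' mulmxBr -!scalemxAr !mulmxA.
  by rewrite [in RHS](addrC (zmx Kc *m p)) addrA subrK addrC.
have n_ap : `|(a 0 0)^-1 *: p| <= 1.
  by rewrite mx_normZ normfV mulrC ler_pdivrMr ?normr_gt0// mul1r -mx_norm11.
have a_ge0 : 0 <= `|a| by [].
have C_ge0 : 0 <= `|C| by [].
apply: mx_norm_block_le; [lra|lra|lra|].
rewrite VE; apply: le_trans (ler_normD _ _) _.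
have : `|(zmx Kc *m a + zmx G' *m c) *m ((a 0 0)^-1 *: p)| <= `|a| / 2.
  apply: le_trans (mx_norm_mul _ _) _; rewrite mul1r.
  by rewrite (le_trans (ler_wpM2l _ n_ap))// mulr1.
have : `|zmx G' *m V'| <= `|C| by apply: le_trans HG' (ler_norm _).
lra.
Qed.

(** * Uniform steering *)

Lemma vec_mx_norm {R : realType} {m n : nat} (v : 'rV[R]_(m * n)) : `|vec_mx v| = `|v|.
Proof.
apply/eqP; rewrite eq_le; apply/andP; split; apply: mx_norm_le => // i j.
  by rewrite mxE mx_entry_le.
rewrite ord1; case: (mxvec_indexP j) => k l.
by rewrite -[v]vec_mxK mxvecE mxvecK mx_entry_le.
Qed.

Lemma vec_mx_continuous {R : realType} {m n : nat} :
  continuous (vec_mx : 'rV[R]_(m * n) -> 'M[R]_(m, n)).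
Proof.
move=> v A /nbhs_ballP[e e0 eA]; apply/nbhs_ballP; exists e => // w vw.
by apply: eA; move: vw; rewrite -!ball_normE /= -linearB/= vec_mx_norm.
Qed.

(** Matrices are flattened to row vectors, to which [bounded_closed_compact] applies. *)
Lemma compact_unimodular {R : realType} {n : nat} (C : R) :
  compact [set v : 'rV[R]_(n * n) | `|v| <= C /\ `|\det (vec_mx v)| = 1].
Proof.
apply: bounded_closed_compact.
  exists C; split; first exact: num_real.
  by move=> x Cx v [vC _]; exact: le_trans vC (ltW Cx).
rewrite [X in closed X](_ : _ = [set v | `|v| <= C] `&` [set v | `|\det (vec_mx v)| = 1])//.
apply: closedI.
  apply: (@closed_comp _ _ (fun v : 'rV[R]_(n * n) => `|v|) [set x | x <= C]).
    by move=> v _; exact: norm_continuous.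
  exact: closed_le.
have det_norm : continuous (fun A : 'M[R]_n => `|\det A|).
  by move=> A; apply: (continuous_comp (@det_continuous R n A)); exact: norm_continuous.
apply: (@closed_comp _ _ (vec_mx : 'rV[R]_(n * n) -> 'M[R]_n) [set A | `|\det A| = 1]).
  by move=> v _; exact: vec_mx_continuous.
apply: (@closed_comp _ _ (fun A : 'M[R]_n => `|\det A|) [set x | x = 1]) => //.
Qed.

Lemma mx_norm_horo {R : realType} {d : nat} (b : 'rV[R]_d) : `|horo b 1%:M| <= `|b| + 1.
Proof.
have n1 m : `|1%:M : 'M[R]_m| <= 1.
  by apply: mx_norm_le => // i j; rewrite mxE; case: eqP => _; rewrite ?normr1 ?normr0.
apply: mx_norm_block_le; rewrite ?normr0 ?addr_ge0// ?lerDl//.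
- by rewrite (le_trans (n1 _))// lerDr.
- by rewrite (le_trans (n1 _))// lerDr.
Qed.

Lemma mx_norm_horoB {R : realType} {d : nat} (b c : 'rV[R]_d) :
  `|horo b 1%:M - horo c 1%:M| <= `|b - c|.
Proof.
rewrite /horo opp_block_mx add_block_mx !subrr.
by apply: mx_norm_block_le; rewrite ?normr0.
Qed.

Lemma horo_act_continuous {R : realType} {d : nat} (G g F : 'M[R]_(1 + d)) (b : 'rV[R]_d) (e : R) :
  0 < e -> exists2 r : R, 0 < r & forall g' b', `|g' - g| < r -> `|b' - b| < r ->
    `|G *m g' *m horo b' 1%:M *m F - G *m g *m horo b 1%:M *m F| < e.
Proof.
move=> e0; pose n : R := (1 + d)%:R.
pose q : R := n * (n * `|G| * (n * (`|b| + 2) + n * `|g|)) * `|F| + 1.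
have n_ge0 : 0 <= n by [].
have q0 : 0 < q by rewrite ltr_wpDl// !mulr_ge0// addr_ge0// mulr_ge0// addr_ge0.
exists (Num.min 1 (e / q)); first by rewrite lt_min ltr01 divr_gt0.
move=> g' b'; rewrite !lt_min => /andP[_ gq] /andP[b1 bq].
have -> : G *m g' *m horo b' 1%:M *m F - G *m g *m horo b 1%:M *m F =
    G *m ((g' - g) *m horo b' 1%:M + g *m (horo b' 1%:M - horo b 1%:M)) *m F.
  by rewrite [(g' - g) *m _]mulmxBl [g *m (_ - _)]mulmxBr addrA subrK mulmxBr mulmxBl !mulmxA.
have nb : `|horo b' 1%:M| <= `|b| + 2.
  have := mx_norm_horo b'; have := ler_normD (b' - b) b; rewrite subrK; lra.
have eq0 : 0 <= e / q by rewrite divr_ge0// ltW.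
apply: (@le_lt_trans _ _ (n * (n * `|G| * (n * (e / q) * (`|b| + 2) + n * `|g| * (e / q))) * `|F|)).
  apply: le_trans (mx_norm_mul _ _) _; rewrite ler_wpM2r// ler_wpM2l//.
  apply: le_trans (mx_norm_mul _ _) _; rewrite ler_wpM2l ?mulr_ge0//.
  apply: le_trans (ler_normD _ _) _; apply: lerD.
    apply: le_trans (mx_norm_mul _ _) _; apply: ler_pM; rewrite ?mulr_ge0//.
    by rewrite ler_wpM2l// ltW.
  apply: le_trans (mx_norm_mul _ _) _; rewrite ler_wpM2l ?mulr_ge0//.
  by rewrite (le_trans (mx_norm_horoB _ _))// ltW.
rewrite [X in X < _](_ : _ = (e / q) * (q - 1)); last by rewrite /q; ring.
by rewrite mulrBr mulr1 divfK ?gt_eqF// ltrBlDr ltrDl divr_gt0.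
Qed.

(** The move found by [steer] also works, with the same [G] and [tau], for nearby matrices and
    nearby moves; compactness makes the constants uniform. The integer [N] packs a lower bound on
    [tau], a bound on [b] and the radius of a ball of admissible moves, the source of the positive
    proportion. *)
Lemma steer_uniform {R : realType} {d : nat} (D : 'M[R]_d) (y : 'rV[R]_d) (eta C : R) :
  `|\det D| = 1 -> 0 < eta ->
  exists N : nat, (0 < N)%N /\ forall g : 'M[R]_(1 + d), `|g| <= C -> `|\det g| = 1 ->
  exists tau : R, N%:R^-1 <= tau /\ exists2 b : 'rV[R]_d, `|b| <= N%:R &
  exists2 G : 'M[int]_(1 + d), G \in unitmx & forall b', `|b' - b| <= N%:R^-1 ->
    `|zmx G *m g *m horo b' 1%:M *m flow d tau - horo y D| < eta.
Proof.
move=> dD eta0.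
pose P (N : nat) (g : 'M[R]_(1 + d)) := exists tau : R, N%:R^-1 <= tau /\
  exists2 b : 'rV[R]_d, `|b| <= N%:R & exists2 G : 'M[int]_(1 + d), G \in unitmx &
  forall b', `|b' - b| <= N%:R^-1 ->
    `|zmx G *m g *m horo b' 1%:M *m flow d tau - horo y D| < eta.
have /compact_near_coveringP cover := @compact_unimodular R (1 + d) C.
have [N0 _ HN] : \forall N \near \oo, [set v : 'rV[R]_((1 + d) * (1 + d)) |
    `|v| <= C /\ `|\det (vec_mx v)| = 1] `<=` (fun v => P N (vec_mx v)).
  apply: (cover _ \oo (fun N v => P N (vec_mx v))) => v [vC dv].
  have [t [t0 [b [G uG HG]]]] := steer (vec_mx v) D y (eta / 2) dv dD (divr_gt0 eta0 (ltr0Sn _ _)).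
  have [r r0 Hr] := horo_act_continuous (zmx G) (vec_mx v) (flow d t) b (eta / 2) (divr_gt0 eta0 (ltr0Sn _ _)).
  (* Any N above this maximum satisfies the three requirements: 1 / N <= t, |b| <= N and 1 / N <
     r. *)
  pose M := Num.max (Num.max t^-1 `|b|) (2 / r).
  exists (ball v r, [set N | (`|Num.ceil M|%N.+1 <= N)%N]).
    by split => /=; [exact: nbhsx_ballx|exists (`|Num.ceil M|%N.+1)].
  case=> v' N /= [vv' NM].
  have MN : M < N%:R.
    apply: le_lt_trans (ceil_ge M) _; apply: le_lt_trans (ler_norm _) _.
    by rewrite -intr_norm -abszE -[_%:~R]/(_%:R) ltr_nat.
  have N0 : 0 < N%:R :> R by rewrite ltr0n (leq_trans _ NM).
  exists t; split; first by rewrite invf_ple ?posrE// ltW// (le_lt_trans _ MN)// /M !le_max lexx.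
  exists b; first by rewrite ltW// (le_lt_trans _ MN)// /M !le_max lexx orbT.
  exists G => // b' bb'.
  have /(Hr _ b') : `|vec_mx v' - vec_mx v| < r.
    by rewrite -linearB/= vec_mx_norm distrC; move: vv'; rewrite -ball_normE.
  have : `|b' - b| < r.
    apply: le_lt_trans bb' _; rewrite invf_plt ?posrE//.
    apply: le_lt_trans MN; rewrite /M le_max; apply/orP; right.
    by have : 0 < r^-1 by [rewrite invr_gt0]; lra.
  move=> /[swap]/[apply] h1.
  by have := ler_distD (zmx G *m vec_mx v *m horo b 1%:M *m flow d t) (zmx G *m vec_mx v' *m horo b' 1%:M *m flow d t) (horo y D); lra.
exists N0.+1; split=> // g gC dg.
have /HN : (N0 <= N0.+1)%N by [].
by move=> /(_ (mxvec g)); rewrite /= mxvecK -vec_mx_norm mxvecK; apply.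
Qed.

(** * Counting the points whose lattice has a short vector *)

Definition hits {R : realType} {d : nat} (y : 'rV[R]_d) (D : 'M[R]_d) (eta : R)
    (x : 'rV[R]_d) (t : R) : Prop :=
  exists2 G : 'M[int]_(1 + d), G \in unitmx &
    `|zmx G *m horo x 1%:M *m flow d t - horo y D| < eta.

Definition thick {R : realType} {d : nat} (eps : R) (x : 'rV[R]_d) (t : R) : Prop :=
  forall m : 'rV[int]_(1 + d), m != 0 -> eps <= `|zmx m *m (horo x 1%:M *m flow d t)|.

Lemma flowD {R : realType} (d : nat) (s t : R) : flow d s *m flow d t = flow d (s * t).
Proof.
rewrite /flow mulmx_block !mulmx0 !mul0mx !addr0 add0r -!scalar_mxM.
by rewrite exprMn invfM.
Qed.

(** A move b made after the flow is a move t^-(d+1) b made before it; this dictates the mesh of the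
    grids. *)
Lemma flow_horo {R : realType} (d : nat) (t : R) (b : 'rV[R]_d) : t != 0 ->
  flow d t *m horo b 1%:M = horo (t ^- d.+1 *: b) 1%:M *m flow d t.
Proof.
move=> t0; rewrite /flow /horo !mulmx_block !mulmx0 !mul0mx !mulmx1 !mul1mx !addr0 !add0r.
congr block_mx; rewrite mul_scalar_mx mul_mx_scalar scalerA exprS invfM mulrA divff// mul1r.
by [].
Qed.

(** A thick lattice has a basis bounded in terms of d and eps, so [steer_uniform] applies with one
    [N]; [flow_horo] and [flowD] translate its move and its time back to x and t. *)
Lemma thick_hits {R : realType} {d : nat} (y : 'rV[R]_d) (D : 'M[R]_d) (eta eps : R) :
  `|\det D| = 1 -> 0 < eta -> 0 < eps ->
  exists N : nat, (0 < N)%N /\ forall x t, 0 < t -> thick eps x t ->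
  exists2 b : 'rV[R]_d, `|b| <= N%:R & exists2 tau : R, N%:R^-1 <= tau &
  forall b', `|b' - b| <= N%:R^-1 -> hits y D eta (x + t ^- d.+1 *: b') (t * tau).
Proof.
move=> dD eta0 eps0.
have [C HC] := @bounded_basis R (1 + d) eps 1 eps0 ler01.
have [N [N0 HN]] := steer_uniform D y eta C dD eta0.
exists N; split=> // x t t0 xt.
have dg : `|\det (horo x 1%:M *m flow d t)| = 1.
  by rewrite det_mulmx det_horo det1 mul1r det_flow ?gt_eqF// normr1.
have [G uG HG] : exists2 G : 'M[int]_(1 + d), G \in unitmx &
    `|zmx G *m (horo x 1%:M *m flow d t)| <= C by apply: HC => //; rewrite dg.
have /(HN _ HG)[tau [tau0 [b b1 [G' uG' HG']]]] :
    `|\det (zmx G *m (horo x 1%:M *m flow d t))| = 1.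
  by rewrite det_mulmx normrM det_zmx// mul1r.
exists b => //; exists tau => // b' /HG' Hb'.
exists (G' *m G); first by rewrite unitmx_mul uG'.
rewrite -flowD map_mxM/= -[zmx G' *m zmx G *m _]mulmxA.
have -> : horo (x + t ^- d.+1 *: b') 1%:M = horo x 1%:M *m horo (t ^- d.+1 *: b') 1%:M.
  by rewrite horoD mulmx1 addrC.
rewrite -!mulmxA (mulmxA _ (flow d t)) -flow_horo ?gt_eqF//.
by move: Hb'; rewrite -!mulmxA.
Qed.

Lemma card_diam {K n : nat} (P : {set 'I_K}) :
  (forall a b, a \in P -> b \in P -> (a <= b)%N -> (b - a < n)%N) -> (#|P| <= n)%N.
Proof.
move=> HP; have [->|[a0 a0P]] := set_0Vmem P; first by rewrite cards0.
have [a aP amin] := arg_minnP (fun i : 'I_K => nat_of_ord i) a0P.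
case: n HP => [|n] HP; first by have := HP _ _ aP aP (leqnn _).
have inj : {in P &, injective (fun b : 'I_K => inord (b - a) : 'I_n.+1)}.
  move=> b c bP cP /(congr1 val); rewrite /= !inordK ?HP ?amin// => e.
  by apply: val_inj; rewrite /= -(subnK (amin _ bP)) e subnK// amin.
by rewrite -(card_in_imset inj) (leq_trans (max_card _))// card_ord.
Qed.

Definition near_integers {R : realType} (K : nat) (u s w : R) : {set 'I_K} :=
  [set a : 'I_K | `[< exists c : int, `|u + s * (nat_of_ord a)%:R - c%:~R| < w >] ]%SET.

(** At most s K + 2 w + 1 integers can be approached within w, and each of them by at most 2 w / s +
    1 indices. *)
Lemma count_near_integers {R : realType} (K : nat) (u s w : R) : 0 < s -> 0 < w ->
  (#|near_integers K u s w|%:R : R) <= (s * K%:R + 2 * w + 1) * (2 * w / s + 1).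
Proof.
move=> s0 w0; pose c0 := Num.floor (u - w) + 1.
have c0gt : u - w < c0%:~R by exact: floorD1_gt.
pose n1 := (Num.truncn (s * K%:R + 2 * w)).+1.
pose n2 := (Num.truncn (2 * w / s)).+1.
pose A (e : 'I_n1) := [set a : 'I_K | `|u + s * (nat_of_ord a)%:R - (c0 + (nat_of_ord e)%:Z)%:~R| < w]%SET.
have sub : near_integers K u s w
    \subset (\bigcup_(e : 'I_n1) A e)%SET.
  apply/fintype.subsetP => a; rewrite inE => /asboolP[c Hc].
  have := Hc; rewrite ltr_norml => /andP[c1 c2].
  have sa : s * (nat_of_ord a)%:R <= s * K%:R by rewrite ler_pM2l// ler_nat ltnW.
  have sa0 : 0 <= s * (nat_of_ord a)%:R by rewrite mulr_ge0// ltW.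
  have c0c : c0 <= c.
    by rewrite /c0 lezD1 -(ltr_int R); apply: le_lt_trans (floor_le _) _; lra.
  have cE : c = c0 + (`|c - c0|%N)%:Z by rewrite gez0_abs ?subr_ge0// addrCA subrr addr0.
  have lt : (`|c - c0| < n1)%N.
    rewrite ltnS truncn_ge_nat; last by rewrite addr_ge0 ?mulr_ge0// ltW.
    have -> : (`|c - c0|%N)%:R = c%:~R - c0%:~R :> R.
      by rewrite -[X in _ = X]rmorphB/= -[in RHS](@gez0_abs (c - c0)) ?subr_ge0.
    lra.
  apply/finset.bigcupP; exists (Ordinal lt) => //; by rewrite inE /= -cE.
have cardA e : (#|A e| <= n2)%N.
  apply: card_diam => a b; rewrite !inE !ltr_norml => /andP[a1 a2] /andP[b1 b2] ab.
  rewrite ltnS truncn_ge_nat; last by rewrite divr_ge0 ?mulr_ge0// ltW.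
  rewrite ler_pdivlMr// natrB// mulrBl [_ * s]mulrC [(nat_of_ord a)%:R * s]mulrC; lra.
have cardU : (#|(\bigcup_(e : 'I_n1) A e)%SET| <= \sum_(e < n1) #|A e|)%N.
  elim/big_ind2 : _ => [|X m Y n Xm Yn|//]; first by rewrite cards0.
  by rewrite (leq_trans (leq_card_setU _ _))// leq_add.
have : (#|near_integers K u s w| <= n1 * n2)%N.
  apply: leq_trans (subset_leq_card sub) (leq_trans cardU _).
  by rewrite -[n1 in (_ <= n1 * _)%N]card_ord -sum_nat_const leq_sum.
rewrite -(ler_nat R) => /le_trans; apply.
have tr (v : R) : 0 <= v -> (Num.truncn v).+1%:R <= v + 1.
  by move=> v0; rewrite -addn1 natrD lerD2r; case/andP: (truncn_itv v0).
by rewrite natrM ler_pM// tr// ?addr_ge0 ?divr_ge0 ?mulr_ge0// ltW.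
Qed.

Definition cell {R : realType} {d : nat} (z : 'rV[R]_d) (h : R) (K : nat)
    (i : {ffun 'I_d -> 'I_K}) : 'rV[R]_d :=
  \row_j (z 0 j + h / K%:R * (nat_of_ord (i j))%:R).

(** A short vector (k / t^d, t (k x + l)) has k nonzero, since for k = 0 the integer vector l would
    have entries below eps / t <= 1. So x has a good simultaneous approximation with denominator
    |k|. *)
Lemma not_thick {R : realType} {d : nat} (eps : R) (x : 'rV[R]_d) (t : R) :
  eps <= 1 -> 1 <= t -> ~ thick eps x t ->
  exists k : nat, [/\ (0 < k)%N, k%:R < eps * t ^+ d &
    forall j, exists c : int, `|k%:R * x 0 j - c%:~R| < eps / t].
Proof.
move=> eps1 t1 /existsNP[m /not_implyP[m0 /negP]]; rewrite -ltNge => Hm.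
have t0 : 0 < t by exact: lt_le_trans t1.
pose k := (lsubmx m) 0 0; pose l := rsubmx m.
have mE : m = row_mx k%:M l by rewrite -mx11_scalar hsubmxK.
have E : zmx m *m (horo x 1%:M *m flow d t) =
    row_mx (k%:~R * t ^- d)%:M (t *: (k%:~R *: x + zmx l)).
  rewrite mE (map_row_mx intr) map_scalar_mx /horo /flow mulmxA.
  rewrite !mul_row_block !mulmx0 !mulmx1 !addr0 add0r -scalar_mxM mul_mx_scalar.
  by rewrite mul_scalar_mx.
rewrite E in Hm.
have hk : `|k%:~R : R| < eps * t ^+ d.
  rewrite -ltr_pdivrMr ?exprn_gt0// -[X in _ / X]ger0_norm ?exprn_ge0 ?(ltW t0)// -normf_div.
  apply: le_lt_trans Hm; have := mx_entry_le (row_mx (k%:~R * t ^- d)%:M (t *: (k%:~R *: x + zmx l))) 0 (lshift d 0).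
  by rewrite row_mxEl !mxE eqxx.
have hl j : `|k%:~R * x 0 j + (l 0 j)%:~R| < eps / t.
  rewrite ltr_pdivlMr// mulrC -[X in X * _]gtr0_norm// -normrM.
  apply: le_lt_trans Hm; have := mx_entry_le (row_mx (k%:~R * t ^- d)%:M (t *: (k%:~R *: x + zmx l))) 0 (rshift 1 j).
  by rewrite row_mxEr !mxE.
exists `|k|%N; split.
- rewrite absz_gt0; apply: contraNneq m0 => k0; rewrite mE k0.
  suff -> : l = 0 by rewrite raddf0 row_mx0.
  apply/rowP => j; have := hl j; rewrite k0 mul0r add0r [RHS]mxE => h1; apply/eqP.
  have : `|(l 0 j)%:~R : R| < 1.
    by apply: lt_le_trans h1 _; rewrite ler_pdivrMr// mul1r (le_trans eps1).
  by rewrite -intr_norm -[1]/(1%:~R) ltr_int; case: (l 0 j) => [[|n]|n].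
- by rewrite natr_absz intr_norm.
- move=> j; have [k0|k0] := leP 0 k.
    by exists (- l 0 j); rewrite natr_absz (ger0_norm k0) mulrNz opprK.
  by exists (l 0 j); rewrite natr_absz (ltr0_norm k0) mulrNz mulNr -opprD normrN.
Qed.

Lemma card_ffun_in {aT rT : finType} (A : aT -> {set rT}) :
  #|[set f : {ffun aT -> rT} | [forall x, f x \in A x]]%SET| = (\prod_x #|A x|)%N.
Proof.
have := @card_family aT (fun=> rT) (fun x => mem (A x)); rewrite foldrE big_map big_enum /= => <-.
by apply: eq_card => f; rewrite inE; apply/forallP/familyP.
Qed.

(** Union bound over the k up to t^d / 16 supplied by [not_thick]: for each k the cells form a
    product of d sets, of proportion at most (1 + 2 / (k h)) / (4 t) each. The total is at most K^d
    / 2^(d+1), half of the (K / 2)^d interior cells that [cover_step] has at its disposal. *)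
Lemma count_not_thick {R : realType} {d : nat} (z : 'rV[R]_d) (h : R) : (0 < d)%N -> 0 < h ->
  exists t1 : nat, forall t K : nat, (t1 <= t)%N -> (0 < t)%N -> h * t%:R ^+ d.+1 <= K%:R ->
  ((#|[set i : {ffun 'I_d -> 'I_K} | `[< ~ thick (1 / 16) (cell z h K i) t%:R >]]%SET| * 2 ^ d.+1)%:R : R)
    <= K%:R ^+ d.
Proof.
(* For k >= k0 the factor 1 + 2 / (k h) is at most 2; each smaller k contributes at most q instead,
   and t >= t1 makes k0 q at most 2^d t^d / 16. *)
move=> d0 h0; pose k0 := (Num.truncn (2 / h)).+1; pose q : R := (1 + 2 / h) ^+ d.
have k0h : 2 / h < k0%:R by exact: truncnS_gt.
have q0 : 0 <= q by rewrite exprn_ge0// addr_ge0// divr_ge0// ltW.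
pose t1 := (Num.truncn (16 * k0%:R * q / 2 ^+ d)).+1.
exists t1 => t K t1t tp Kh.
pose T := (t ^ d)%N; pose n := (T %/ 16)%N.
have tR : 0 < t%:R :> R by rewrite ltr0n.
have T0 : 0 < T%:R :> R by rewrite ltr0n expn_gt0 tp.
have TE : T%:R = t%:R ^+ d :> R by rewrite natrX.
have nT : n%:R <= T%:R / 16 :> R by rewrite ler_pdivlMr// -natrM ler_nat leq_trunc_div.
have K0 : 0 < K%:R :> R by apply: lt_le_trans Kh; rewrite mulr_gt0// exprn_gt0.
pose A (e : 'I_n) (j : 'I_d) : {set 'I_K} :=
  near_integers K (e.+1%:R * z 0 j) (e.+1%:R * (h / K%:R)) (1 / 16 / t%:R).
have sub : [set i : {ffun 'I_d -> 'I_K} | `[< ~ thick (1 / 16) (cell z h K i) t%:R >]]%SET \subset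
    (\bigcup_(e < n) [set i : {ffun 'I_d -> 'I_K} | [forall j, i j \in A e j]])%SET.
  apply/fintype.subsetP => i; rewrite inE => /asboolP/not_thick[||k [kp kT Hk]].
  - by rewrite ler_pdivrMr// mul1r ler1n.
  - by rewrite ler1n.
  have kn : (k.-1 < n)%N.
    rewrite prednK// leq_divRL//; rewrite -(ler_nat R) natrM TE; lra.
  apply/finset.bigcupP; exists (Ordinal kn) => //; rewrite inE; apply/forallP => j.
  rewrite inE; apply/asboolP; have [c Hc] := Hk j; exists c; rewrite /= prednK//.
  move: Hc; rewrite mxE.
  by rewrite mulrDr mulrA.
have cardU : (#|(\bigcup_(e < n) [set i : {ffun 'I_d -> 'I_K} | [forall j, i j \in A e j]])%SET|
    <= \sum_(e < n) \prod_j #|A e j|)%N.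
  rewrite [leqRHS](_ : _ = \sum_(e < n) #|[set i : {ffun 'I_d -> 'I_K} | [forall j, i j \in A e j]]%SET|)%N; last first.
    by apply: eq_bigr => e _; rewrite card_ffun_in.
  elim/big_ind2 : _ => [|X m Y p Xm Yp|//]; first by rewrite cards0.
  by rewrite (leq_trans (leq_card_setU _ _))// leq_add.
have cardA (e : 'I_n) j : #|A e j|%:R <= K%:R / (4 * t%:R) * (1 + 2 / (e.+1%:R * h)).
  have e0 : 0 < e.+1%:R :> R by rewrite ltr0n.
  apply: le_trans (count_near_integers K (e.+1%:R * z 0 j) (e.+1%:R * (h / K%:R)) (1 / 16 / t%:R) _ _) _.
  - by rewrite !mulr_gt0// invr_gt0.
  - by rewrite !divr_gt0.
  have t11 : t%:R^-1 <= 1 :> R by rewrite invf_le1// ler1n.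
  have b1 : e.+1%:R * (h / K%:R) * K%:R + 2 * (1 / 16 / t%:R) + 1 <= e.+1%:R * h + 2.
    by rewrite mulrA divfK ?gt_eqF//; lra.
  (* With k = e + 1, the first term is K / (8 t k h); since 16 k <= t^d and h t^(d+1) <= K it is at
     least 1, so the final + 1 at most doubles it. *)
  have b2 : 2 * (1 / 16 / t%:R) / (e.+1%:R * (h / K%:R)) + 1 <= K%:R / (4 * t%:R * e.+1%:R * h).
    have : 1 <= K%:R / (8 * t%:R * e.+1%:R * h).
      rewrite ler_pdivlMr ?mulr_gt0// mul1r (le_trans _ Kh)//.
      have : e.+1%:R * 16 <= T%:R :> R by rewrite -natrM ler_nat -leq_divRL.
      rewrite TE exprS => eT.
      rewrite [X in X <= _](_ : _ = h * t%:R * (8 * e.+1%:R)); last by ring.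
      rewrite [leRHS]mulrA ler_pM2l ?mulr_gt0//; lra.
    have -> : 2 * (1 / 16 / t%:R) / (e.+1%:R * (h / K%:R)) = K%:R / (8 * t%:R * e.+1%:R * h).
      by field; rewrite !gt_eqF.
    have -> : K%:R / (4 * t%:R * e.+1%:R * h) = 2 * (K%:R / (8 * t%:R * e.+1%:R * h)).
      by field; rewrite !gt_eqF.
    by move: (K%:R / _) => X X1; lra.
  have h_ge0 := ltW h0.
  apply: le_trans (ler_pM _ _ b1 b2) _; [by rewrite !(addr_ge0, mulr_ge0, invr_ge0) ..|].
  rewrite le_eqVlt; apply/orP; left; apply/eqP; field.
  by rewrite !gt_eqF.
have cardP (e : 'I_n) : (\prod_j #|A e j|)%:R <=
    (K%:R / 4) ^+ d / T%:R * (2 ^+ d + (if (e.+1 < k0)%N then q else 0)).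
  rewrite natr_prod.
  apply: (@le_trans _ _ (\prod_(j < d) (K%:R / (4 * t%:R) * (1 + 2 / (e.+1%:R * h))))).
    by apply: ler_prod => j _; rewrite ler0n cardA.
  have e0 : 0 < e.+1%:R :> R by rewrite ltr0n.
  rewrite prodr_const card_ord exprMn TE.
  have -> : (K%:R / (4 * t%:R)) ^+ d = (K%:R / 4) ^+ d / t%:R ^+ d :> R.
    by rewrite -expr_div_n; congr (_ ^+ _); field; rewrite gt_eqF.
  rewrite ler_wpM2l ?divr_ge0 ?exprn_ge0 ?divr_ge0//.
  have h_ge0 := ltW h0.
  have p1 : 0 <= 1 + 2 / (e.+1%:R * h) by rewrite !(addr_ge0, mulr_ge0, invr_ge0).
  case: ltnP => ek.
    apply: (@le_trans _ _ q); last by rewrite lerDr exprn_ge0.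
    rewrite lerXn2r ?nnegrE ?p1 ?addr_ge0 ?divr_ge0// lerD2l ler_pdivrMr ?mulr_gt0//.
    rewrite (_ : 2 / h * _ = 2 * e.+1%:R); last by field; rewrite gt_eqF.
    by rewrite ler_peMr// ler1n.
  rewrite addr0 lerXn2r ?nnegrE//.
  rewrite -[leRHS]/(1 + 1) lerD2l ler_pdivrMr ?mulr_gt0// mul1r -ler_pdivrMr//.
  by rewrite (le_trans (ltW k0h))// ler_nat.
have tot : (#|[set i : {ffun 'I_d -> 'I_K} | `[< ~ thick (1 / 16) (cell z h K i) t%:R >]]%SET|)%:R
   <= (K%:R / 4) ^+ d / T%:R * (n%:R * 2 ^+ d + k0%:R * q) :> R.
  apply: (@le_trans _ _ (\sum_(e < n) \prod_j #|A e j|)%:R).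
    by rewrite ler_nat (leq_trans (subset_leq_card sub)).
  rewrite natr_sum; apply: le_trans (ler_sum _ (fun e _ => cardP e)) _.
  rewrite -mulr_sumr ler_wpM2l ?divr_ge0 ?exprn_ge0 ?divr_ge0//.
  rewrite big_split/= sumr_const card_ord -[_ *+ n]mulr_natl lerD2l.
  rewrite -big_mkcond/= (eq_bigl (fun e => e \in [set e : 'I_n | (e.+1 < k0)%N]%SET)); last first.
    by move=> e; rewrite inE.
  rewrite sumr_const -[_ *+ _]mulr_natl ler_wpM2r// ler_nat.
  apply: card_diam => a b; rewrite !inE => _ bk _.
  by rewrite (leq_ltn_trans (leq_subr _ _))// ltnW.
have kq : k0%:R * q <= T%:R * 2 ^+ d / 16.
  have : 16 * k0%:R * q / 2 ^+ d < t1%:R by exact: truncnS_gt.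
  rewrite ltr_pdivrMr ?exprn_gt0// => h1.
  have : t1%:R <= T%:R :> R.
    by rewrite ler_nat (leq_trans t1t)// -{1}[t]expn1 leq_pexp2l.
  rewrite -(ler_pM2r (_ : 0 < 2 ^+ d :> R)) ?exprn_gt0// => h2.
  by rewrite ler_pdivlMr//; lra.
have nq : n%:R * 2 ^+ d <= T%:R / 16 * 2 ^+ d :> R by rewrite ler_wpM2r ?exprn_ge0.
rewrite natrM natrX.
have c0 : 0 <= (K%:R / 4 : R) ^+ d / T%:R by rewrite divr_ge0 ?exprn_ge0 ?divr_ge0.
apply: (@le_trans _ _ ((K%:R / 4) ^+ d / T%:R * (T%:R * 2 ^+ d / 8) * 2 ^+ d.+1)).
  rewrite ler_wpM2r ?exprn_ge0// (le_trans tot)// ler_wpM2l//; lra.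
have -> : (K%:R / 4) ^+ d / T%:R * (T%:R * 2 ^+ d / 8) * 2 ^+ d.+1 = K%:R ^+ d / 4 :> R.
  have e4 : (4 : R) ^+ d = 2 ^+ d * 2 ^+ d by rewrite -exprMn -natrM.
  by rewrite exprS expr_div_n e4; field; rewrite gt_eqF// expf_neq0.
by rewrite ler_pdivrMr// ler_peMr ?exprn_ge0// ler1n.
Qed.

(** * Covering by cells that miss the target *)

Definition cube {R : realType} {d : nat} (z : 'rV[R]_d) (h : R) : set 'rV[R]_d :=
  [set x | forall j, z 0 j <= x 0 j <= z 0 j + h].

Lemma cube_cell {R : realType} {d : nat} (z : 'rV[R]_d) (h : R) (K : nat) x :
  0 < h -> (0 < K)%N -> cube z h x -> exists i : {ffun 'I_d -> 'I_K},
    cube (cell z h K i) (h / K%:R) x.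
Proof.
move=> h0 K0 zx; have KR : 0 < K%:R :> R by rewrite ltr0n.
have /choice[f Hf] : forall j, exists a : 'I_K,
    z 0 j + h / K%:R * (nat_of_ord a)%:R <= x 0 j <= z 0 j + h / K%:R * (nat_of_ord a)%:R + h / K%:R.
  move=> j; have /andP[x1 x2] := zx j.
  pose v := (x 0 j - z 0 j) * K%:R / h.
  have v0 : 0 <= v by rewrite !mulr_ge0// ?subr_ge0// invr_ge0 ltW.
  have vK : v <= K%:R by rewrite ler_pdivrMr// mulrC ler_wpM2l// lerBlDl.
  have xE : x 0 j = z 0 j + h / K%:R * v by rewrite /v; field; rewrite !gt_eqF.
  have hK : 0 < h / K%:R by rewrite divr_gt0.
  suff [a /andP[a1 a2]] : exists a : 'I_K, (nat_of_ord a)%:R <= v <= (nat_of_ord a)%:R + 1.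
    exists a; rewrite xE lerD2l ler_pM2l// a1/= -addrA lerD2l.
    by rewrite -[X in _ + X]mulr1 -mulrDr ler_pM2l.
  have /andP[t1 t2] := truncn_itv v0.
  have [tK|tK] := ltnP (Num.truncn v) K.
    by exists (Ordinal tK); rewrite t1 /= natr1 ltW.
  (* The right end of the range, v = K, belongs to the last cell. *)
  have K1 : (K.-1 < K)%N by rewrite prednK.
  exists (Ordinal K1); rewrite /= natr1 prednK// vK andbT.
  by rewrite (le_trans _ t1)// ler_nat (leq_trans (leq_pred _)).
exists [ffun j => f j] => j; rewrite mxE ffunE; exact: Hf.
Qed.

Lemma card_interior (K m : nat) :
  (K - 2 * m <= #|[set a : 'I_K | (m <= a)%N && (a + m < K)%N]%SET|)%N.
Proof.
pose A : {set 'I_K} := [set a : 'I_K | (m <= a)%N && (a + m < K)%N]%SET.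
pose B1 : {set 'I_K} := [set a : 'I_K | (a < m)%N]%SET.
pose B2 : {set 'I_K} := [set a : 'I_K | (K <= a + m)%N]%SET.
have sub : [set: 'I_K]%SET \subset (A :|: (B1 :|: B2))%SET.
  apply/fintype.subsetP => a _; rewrite !inE.
  by case: (leqP m a) => //= _; case: (leqP K (a + m)).
have b1 : (#|B1| <= m)%N.
  by apply: card_diam => a b; rewrite !inE => _ bm _; rewrite (leq_ltn_trans (leq_subr _ _)).
have b2 : (#|B2| <= m)%N.
  by apply: card_diam => a b; rewrite !inE => aK _ ab; have := ltn_ord b; lia.
have KA := subset_leq_card sub; rewrite cardsT card_ord in KA.
rewrite leq_subLR (leq_trans KA)// (leq_trans (leq_card_setU _ _))// addnC leq_add2r.
by rewrite (leq_trans (leq_card_setU _ _))// mul2n -addnn leq_add.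
Qed.

Lemma shift_ord (K m n i : nat) (e : int) : (n < m)%N -> (m <= i)%N -> (i + m < K)%N ->
  `|e| <= n%:Z -> exists2 a : 'I_K, (nat_of_ord a)%:Z = i%:Z + e & (i <= a + m)%N && (a <= i + m)%N.
Proof.
move=> nm mi iK en; have lt : (absz (i%:Z + e)%R < K)%N by lia.
by exists (Ordinal lt) => /=; lia.
Qed.

Lemma card_ball_ord (K m c : nat) :
  (#|[set a : 'I_K | (a <= c + m)%N && (c <= a + m)%N]%SET| <= 2 * m + 1)%N.
Proof. by apply: card_diam => a b; rewrite !inE; lia. Qed.

Lemma card_interior_half (K m : nat) : (4 * m <= K)%N ->
  (K <= #|[set a : 'I_K | (m <= a)%N && (a + m < K)%N]%SET| * 2)%N.
Proof. by have := card_interior K m; move: #|_| => c; lia. Qed.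

Lemma norm_floor_le {R : realType} (v : R) (n : nat) : `|v| <= n%:R -> `|Num.floor v| <= n%:Z.
Proof.
rewrite !ler_norml => /andP[v1 v2]; rewrite floor_ge_int rmorphN/= v1/=.
by rewrite -(ler_int R) (le_trans (floor_le _)).
Qed.

(* A good interior cell [i] forces a cell within distance [m] of [i] to consist of hitting points
   only, and such a cell comes from at most [(2 m + 1) ^ d] good ones. *)
Lemma cover_step {R : realType} {d : nat} (y : 'rV[R]_d) (D : 'M[R]_d) (eta : R) :
  (0 < d)%N -> `|\det D| = 1 -> 0 < eta ->
  exists2 c : R, 0 < c <= 1 & forall t0 z h, 0 < h ->
  exists K : nat, (0 < K)%N /\ exists2 J : {set {ffun 'I_d -> 'I_K}},
    #|J|%:R <= (1 - c) * K%:R ^+ d &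
    forall x, cube z h x -> (forall t, t0 <= t -> ~ hits y D eta x t) ->
      exists2 i, i \in J & cube (cell z h K i) (h / K%:R) x.
Proof.
move=> d0 dD eta0.
have eps0 : 0 < 1 / 16 :> R by rewrite divr_gt0.
have [N [N0 HN]] := thick_hits y D eta (1 / 16) dD eta0 eps0.
have NR : 0 < N%:R :> R by rewrite ltr0n.
(* A move of size N / t^(d+1) spans at most 2 N^2 cells of side h / K, because K will be at most 2 h
   t^(d+1) N. *)
pose m := (2 * N ^ 2).+1.
(* Good interior cells number at least (K / 2)^d - K^d / 2^(d+1) = K^d / 2^(d+1), and up to (2 m +
   1)^d of them may share one hitting cell. *)
pose c : R := (2 ^+ d.+1)^-1 / (2 * m + 1)%:R ^+ d.
have m0 : 0 < (2 * m + 1)%:R ^+ d :> R by rewrite exprn_gt0// ltr0n addn1.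
have c0 : 0 < c by rewrite divr_gt0// invr_gt0 exprn_gt0.
have c1 : c <= 1.
  rewrite /c ler_pdivrMr// mul1r (@le_trans _ _ 1)//.
    by rewrite invf_le1 ?exprn_gt0// exprn_ege1// ler1n.
  by rewrite exprn_ege1// ler1n addn1.
exists c; first by rewrite c0.
move=> t0 z h h0.
have [t1 Ht1] := count_not_thick z h d0 h0.
(* The three terms serve the count of bad cells, the bound t tau >= t / N >= t0, and K >= 4 m, by
   which at least half of the indices in each coordinate are interior. *)
pose t := (t1 + (Num.truncn (N%:R * `|t0|)).+1 + (Num.truncn ((4 * m + 1)%:R / h)).+1)%N.
have t_gt0 : (0 < t)%N by rewrite /t !addnS.
have tR : 0 < t%:R :> R by rewrite ltr0n.
have tt0 : N%:R * `|t0| <= t%:R.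
  by apply: le_trans (ltW (truncnS_gt _)) _; rewrite ler_nat /t (leq_trans (leq_addl _ _) (leq_addr _ _)).
have th : (4 * m + 1)%:R / h <= t%:R ^+ d.+1.
  apply: le_trans (ltW (truncnS_gt _)) _; apply: (@le_trans _ _ t%:R).
    by rewrite ler_nat leq_addl.
  by rewrite -[leLHS]expr1 ler_eXnr// ler1n.
pose rho : R := t%:R ^+ d.+1.
have rho0 : 0 < rho by rewrite exprn_gt0.
(* K > S makes the side h / K at most t^-(d+1) / N, the radius within which a move may vary. *)
pose S := h * rho * N%:R.
have hr : (4 * m + 1)%:R <= h * rho by rewrite -ler_pdivrMl// mulrC.
have hS : h * rho <= S by rewrite /S ler_peMr ?ler1n// mulr_ge0// ltW.
have S1 : 1 <= S.
  by apply: le_trans hS; apply: le_trans hr; rewrite ler1n addn1.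
have S0 : 0 < S by exact: lt_le_trans S1.
pose K := (Num.truncn S).+1.
have SK : S < K%:R by exact: truncnS_gt.
have K2S : K%:R <= 2 * S.
  rewrite /K -addn1 natrD; have /andP[] := truncn_itv (ltW S0); lra.
have K0 : 0 < K%:R :> R by rewrite ltr0n.
have Km : (4 * m <= K)%N.
  rewrite -(ler_nat R) ltW//; apply: lt_trans SK; apply: lt_le_trans hS; apply: lt_le_trans hr.
  by rewrite ltr_nat addn1.
have hK : h / K%:R <= rho^-1 / N%:R.
  have -> : rho^-1 / N%:R = h / S by rewrite /S; field; rewrite !gt_eqF.
  by rewrite ler_pM2l// lef_pV2 ?posrE// ltW.
exists K; split=> //.
pose bad : {set {ffun 'I_d -> 'I_K}} := [set i | `[< ~ thick (1 / 16) (cell z h K i) t%:R >]]%SET.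
have Hbad : ((#|bad| * 2 ^ d.+1)%:R : R) <= K%:R ^+ d.
  by apply: Ht1 => //; [rewrite /t -addnA leq_addr|rewrite (le_trans hS)// ltW].
pose I0 : {set {ffun 'I_d -> 'I_K}} :=
  [set i : {ffun 'I_d -> 'I_K} | [forall j, i j \in [set a : 'I_K | (m <= a)%N && (a + m < K)%N]%SET]]%SET.
pose H : {set {ffun 'I_d -> 'I_K}} := [set i | `[< forall x, cube (cell z h K i) (h / K%:R) x ->
  exists2 s, t0 <= s & hits y D eta x s >]]%SET.
pose near (i' : {ffun 'I_d -> 'I_K}) : {set {ffun 'I_d -> 'I_K}} :=
  [set i : {ffun 'I_d -> 'I_K} | [forall j, i j \in [set a : 'I_K | (a <= i' j + m)%N && (i' j <= a + m)%N]%SET]]%SET.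
have Hnear i : i \in I0 -> i \notin bad -> exists2 i', i' \in H & i \in near i'.
  rewrite inE => /forallP iI; rewrite inE => /asboolP/contrapT it.
  have [b bN [tau tauN Hb]] := HN _ _ tR it.
  (* The move rounded down to whole cells: the shifted cell contains the corner of cell [i] moved by
     t^-(d+1) b, so all of its points are admissible moves. *)
  pose e j := Num.floor (rho^-1 * b 0 j * K%:R / h).
  have he j : `|e j| <= Posz (2 * N ^ 2).
    apply: norm_floor_le; rewrite !normrM normfV (gtr0_norm rho0) normfV (gtr0_norm h0) (gtr0_norm K0).
    have bj : `|b 0 j| <= N%:R by exact: le_trans (mx_entry_le _ _ _) bN.
    rewrite ler_pdivrMr// (@le_trans _ _ (rho^-1 * N%:R * (2 * S)))//.
      by rewrite ler_pM ?mulr_ge0 ?invr_ge0 ?(ltW rho0)// ler_wpM2l ?invr_ge0 ?(ltW rho0).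
    rewrite natrM natrX le_eqVlt; apply/orP; left; apply/eqP; rewrite /S.
    by field; rewrite gt_eqF.
  have /choice[f Hf] : forall j, exists a : 'I_K, (nat_of_ord a)%:Z = (nat_of_ord (i j))%:Z + e j /\
      (i j <= a + m)%N && (a <= i j + m)%N.
    move=> j; have := iI j; rewrite inE => /andP[i1 i2].
    by have [a a1 a2] := shift_ord _ _ _ _ _ (ltnSn _) i1 i2 (he j); exists a.
  exists [ffun j => f j]; last first.
    by rewrite inE; apply/forallP => j; rewrite inE ffunE; have [_] := Hf j.
  rewrite inE; apply/asboolP => x Hx.
  exists (t%:R * tau).
    apply: le_trans (ler_norm _) _; move: tt0; rewrite -ler_pdivlMl// => /le_trans; apply.
    by rewrite mulrC ler_wpM2l// ltW.
  have -> : x = cell z h K i + t%:R ^- d.+1 *: (t%:R ^+ d.+1 *: (x - cell z h K i)).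
    by rewrite scalerA mulVf ?gt_eqF// scale1r addrC subrK.
  apply: Hb; apply: mx_norm_le => [|i0 j]; first by rewrite invr_ge0 ltW.
  rewrite ord1 {i0} -/rho; have [fj _] := Hf j; have := Hx j.
  have -> : (rho *: (x - cell z h K i) - b) 0 j = rho * (x 0 j - cell z h K i 0 j) - b 0 j.
    by rewrite !mxE.
  have cE (k : {ffun 'I_d -> 'I_K}) : cell z h K k 0 j = z 0 j + h / K%:R * (nat_of_ord (k j))%:R.
    by rewrite mxE.
  rewrite !cE ffunE.
  have -> : (nat_of_ord (f j))%:R = (nat_of_ord (i j))%:R + (e j)%:~R :> R.
    by rewrite -[LHS]/((nat_of_ord (f j))%:Z%:~R) fj rmorphD.
  set u := h / K%:R in hK *.
  have u0 : 0 < u by rewrite divr_gt0.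
  have : (e j)%:~R <= rho^-1 * b 0 j * K%:R / h by exact: floor_le.
  have : rho^-1 * b 0 j * K%:R / h < (e j)%:~R + 1 by rewrite -[1]/(1%:~R) -rmorphD; exact: floorD1_gt.
  have bE : b 0 j = rho * (u * (rho^-1 * b 0 j * K%:R / h)).
    by rewrite /u; field; rewrite !gt_eqF.
  rewrite [in X in _ -> _ -> _ -> X]bE; move: (_ * K%:R / h) ((e j)%:~R : R) => v E v1 v2 /andP[x1 x2].
  rewrite -mulrBr normrM gtr0_norm//.
  have : rho * u <= N%:R^-1 by rewrite -ler_pdivlMl.
  apply: le_trans; rewrite ler_pM2l// ler_norml.
  have : u * E <= u * v by rewrite ler_pM2l.
  have : u * v < u * (E + 1) by rewrite ltr_pM2l.
  by rewrite !mulrDr mulr1 in x1 x2 *; move=> ? ?; apply/andP; split; lra.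
have cardnear i' : (#|near i'| <= (2 * m + 1) ^ d)%N.
  rewrite card_ffun_in -[X in (_ <= _ ^ X)%N]card_ord -prod_nat_const.
  by apply: leq_prod => j _; exact: card_ball_ord.
have cardG : (#|I0 :\: bad| <= #|H| * (2 * m + 1) ^ d)%N.
  have sub : (I0 :\: bad)%SET \subset (\bigcup_(i' in H) near i')%SET.
    apply/fintype.subsetP => i; rewrite inE => /andP[ib iI].
    by have [i' i'H ii'] := Hnear i iI ib; apply/finset.bigcupP; exists i'.
  apply: leq_trans (subset_leq_card sub) _; rewrite -sum_nat_const.
  apply: (@leq_trans (\sum_(i' in H) #|near i'|)%N); last by apply: leq_sum.
  elim/big_ind2 : _ => [|X k Y p Xm Yp|//]; first by rewrite cards0.
  by rewrite (leq_trans (leq_card_setU _ _))// leq_add.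
have cardI : (K%:R / 2) ^+ d <= #|I0|%:R :> R.
  rewrite card_ffun_in natr_prod -[X in _ ^+ X]card_ord -prodr_const.
  apply: ler_prod => j _; rewrite divr_ge0//=.
  rewrite ler_pdivrMr// -natrM ler_nat.
  exact: card_interior_half.
have cardH : c * K%:R ^+ d <= #|H|%:R.
  have h1 : #|I0|%:R <= #|bad|%:R + #|H|%:R * (2 * m + 1)%:R ^+ d :> R.
    rewrite -natrX -natrM -natrD ler_nat.
    rewrite -(cardsID bad I0) leq_add// subset_leq_card//; exact: finset.subsetIr.
  have p0 : 0 < 2 ^+ d.+1 :> R by rewrite exprn_gt0.
  rewrite /c mulrAC ler_pdivrMr// ler_pdivrMl//.
  move: Hbad; rewrite natrM natrX => Hb.
  have : 2 ^+ d.+1 * (K%:R / 2) ^+ d = 2 * K%:R ^+ d :> R.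
    by rewrite exprS -mulrA -exprMn; congr (_ * _ ^+ _); rewrite mulrC divfK.
  have : 2 ^+ d.+1 * (K%:R / 2) ^+ d <= 2 ^+ d.+1 * (#|bad|%:R + #|H|%:R * (2 * m + 1)%:R ^+ d) :> R.
    by rewrite ler_pM2l// (le_trans cardI).
  rewrite mulrDr [_ * #|bad|%:R]mulrC; lra.
exists (~: H)%SET.
  have := cardsC H; rewrite card_ffun !card_ord => /(congr1 (fun n => n%:R : R)).
  rewrite natrD natrX; lra.
move=> x zx nx; have [i Hi] := cube_cell z h K x h0 isT zx; exists i => //.
rewrite inE; apply/negP; rewrite inE => /asboolP/(_ x Hi)[s ts]; exact: nx.
Qed.

(** The constant of [cover_step] is fixed before the cube, so each round multiplies the total volume
    of the remaining cubes by at most 1 - c, although K may vary from cube to cube. *)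
Lemma cover_iter {R : realType} {d : nat} (y : 'rV[R]_d) (D : 'M[R]_d) (eta t0 : R) :
  (0 < d)%N -> `|\det D| = 1 -> 0 < eta ->
  exists2 c : R, 0 < c <= 1 & forall k z h, 0 < h ->
  exists s : seq ('rV[R]_d * R), [/\ forall p, p \in s -> 0 < p.2,
    \sum_(p <- s) p.2 ^+ d <= (1 - c) ^+ k * h ^+ d &
    forall x, cube z h x -> (forall t, t0 <= t -> ~ hits y D eta x t) ->
      exists2 p, p \in s & cube p.1 p.2 x].
Proof.
move=> d0 dD eta0; have [c c01 step] := cover_step y D eta d0 dD eta0.
have /andP[c0 c1] := c01; exists c => //.
elim=> [|k IHk] z h h0.
  exists [:: (z, h)]; split=> [p||x xz _].
  - by rewrite inE => /eqP ->.
  - by rewrite big_seq1 expr0 mul1r.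
  - by exists (z, h); rewrite ?inE.
have [K [K0 [J cJ HJ]]] := step t0 z h h0.
have KR : 0 < K%:R :> R by rewrite ltr0n.
have hK : 0 < h / K%:R by rewrite divr_gt0.
have /choice[S HS] := fun i : {ffun 'I_d -> 'I_K} => IHk (cell z h K i) _ hK.
exists (flatten [seq S i | i <- enum J]); split.
- by move=> p /flattenP[_ /mapP[i _ ->]]; have [+ _ _] := HS i; apply.
- rewrite big_flatten big_map big_enum /=.
  apply: (@le_trans _ _ (\sum_(i in J) (1 - c) ^+ k * (h / K%:R) ^+ d)).
    by apply: ler_sum => i _; have [] := HS i.
  rewrite sumr_const -[leLHS]mulr_natl.
  apply: (@le_trans _ _ ((1 - c) * K%:R ^+ d * ((1 - c) ^+ k * (h / K%:R) ^+ d))).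
    by rewrite ler_wpM2r ?mulr_ge0 ?exprn_ge0 ?subr_ge0 ?(ltW hK).
  rewrite le_eqVlt; apply/orP; left; apply/eqP.
  have -> : h ^+ d = K%:R ^+ d * (h / K%:R) ^+ d by rewrite -exprMn mulrC divfK// gt_eqF.
  by rewrite exprS; ring.
- move=> x xz Hx; have [i iJ xi] := HJ x xz Hx.
  have [_ _ /(_ x xi Hx)[p pS xp]] := HS i.
  exists p => //; apply/flattenP; exists (S i) => //.
  by apply: map_f; rewrite mem_enum.
Qed.

(** Jordan content zero: covers are finite lists, as the iteration produces them. *)
Definition small_covers {R : realType} {d : nat} (A : set 'rV[R]_d) : Prop :=
  forall eps : R, 0 < eps -> exists s : seq ('rV[R]_d * 'rV[R]_d),
    [/\ forall p i, p \in s -> p.1 ord0 i <= p.2 ord0 i,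
        A `<=` [set x | exists2 p, p \in s & box p.1 p.2 x]
      & \sum_(p <- s) box_vol p.1 p.2 <= eps].

Lemma sum_nth_le {R : realType} {T : Type} (f : T -> R) (x0 : T) (s : seq T) (M : nat) :
  (forall j, 0 <= f (nth x0 s j)) -> f x0 = 0 -> \sum_(j < M) f (nth x0 s j) <= \sum_(x <- s) f x.
Proof.
elim: s M => [|x s IH] M f0 fx0.
  by rewrite big_nil big1// => i _; rewrite nth_nil.
have fs j : 0 <= f (nth x0 s j) by exact: (f0 j.+1).
case: M => [|M].
  rewrite big_ord0 big_cons addr_ge0 ?(f0 0)//.
  by apply: le_trans (IH 0%N fs fx0); rewrite big_ord0.
by rewrite big_ord_recl big_cons lerD2l; exact: IH.
Qed.

(** [pickle_inv] is injective where it is defined, so the partial sum visits each pair of the square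
    at most once. *)
Lemma sum_pickle_inv {R : realType} (f : nat * nat -> R) (n M : nat) :
  (forall p, 0 <= f p) ->
  (forall k p, (k < n)%N -> pickle_inv k = Some p -> (p.1 < M)%N && (p.2 < M)%N) ->
  \sum_(k < n) (if pickle_inv k is Some p then f p else 0) <= \sum_(i < M) \sum_(j < M) f (val i, val j).
Proof.
move=> f0 HM.
rewrite pair_bigA /=.
have -> : \sum_(k < n) (if pickle_inv k is Some p then f p else 0) =
    \sum_(k < n) \sum_(q : 'I_M * 'I_M)
      (if pickle_inv k == Some (val q.1, val q.2) then f (val q.1, val q.2) else 0).
  apply: eq_bigr => k _; case E : (pickle_inv k) => [p|]; last by rewrite big1.
  have /andP[p1 p2] := HM _ _ (ltn_ord k) E.
  rewrite (bigD1 (Ordinal p1, Ordinal p2))//= big1 ?addr0.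
    by rewrite -surjective_pairing eqxx.
  move=> [q1 q2] /eqP qn; case: eqP => // -[e]; case: qn; congr pair; apply: val_inj; rewrite /= ?e//.
rewrite exchange_big/=; apply: ler_sum => q _.
have [k0|nk] := pselect (exists k : 'I_n, pickle_inv k == Some (val q.1, val q.2)).
  have [k kq] := k0; rewrite (bigD1 k)//= kq big1 ?addr0// => k' k'k.
  case: eqP => // e; case/eqP: k'k; apply: val_inj => /=.
  have /= := @pickle_invK (nat * nat)%type k'; rewrite e /= => <-.
  by have /= := @pickle_invK (nat * nat)%type k; rewrite (eqP kq) /=.
rewrite big1// => k _; case: ifP => // kq; case: nk; by exists k.
Qed.

Lemma null_bigcup {R : realType} {d : nat} (A : nat -> set 'rV[R]_d) : (0 < d)%N ->
  (forall n, small_covers (A n)) -> lebesgue_null (\bigcup_n A n).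
Proof.
move=> d0 HA eps eps0.
have /choice[s Hs] := fun n => HA n (eps / 2 ^+ n.+1) (divr_gt0 eps0 (exprn_gt0 _ (ltr0Sn _ _))).
(* Lists are padded with the degenerate box (0, 0), whose volume is 0 because d > 0. *)
pose b (p : nat * nat) := nth (0, 0) (s p.1) p.2.
have b_le p i : (b p).1 ord0 i <= (b p).2 ord0 i.
  rewrite /b; have [ps|ps] := ltnP p.2 (size (s p.1)).
    by have [+ _ _] := Hs p.1; apply; exact: mem_nth.
  by rewrite nth_default.
pose c (k : nat) := if pickle_inv k is Some p then b p else (0, 0).
have vol0 : box_vol (0 : 'rV[R]_d) 0 = 0.
  by rewrite /box_vol (bigD1 (Ordinal d0))//= subrr mul0r.
have vol_ge0 p : 0 <= box_vol (b p).1 (b p).2.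
  by apply: prodr_ge0 => i _; rewrite subr_ge0.
exists (fun k => (c k).1), (fun k => (c k).2); split.
- by move=> k i; rewrite /c; case: pickle_inv.
- move=> x [n _ Anx]; have [_ /(_ x Anx)[p ps xp] _] := Hs n.
  exists (pickle (n, index p (s n))) => //=; rewrite /c pickleK_inv /b /= nth_index//.
- move=> n.
  pose M := (\max_(k < n) (if pickle_inv k is Some p then maxn p.1 p.2 else 0)).+1.
  have HM k p : (k < n)%N -> pickle_inv k = Some p -> (p.1 < M)%N && (p.2 < M)%N.
    move=> kn E; have := @leq_bigmax 'I_n (fun k => if pickle_inv k is Some p then maxn p.1 p.2 else 0%N) (Ordinal kn).
    by rewrite /= E geq_max => /andP[]; rewrite /M !ltnS => -> ->.
  have -> : \sum_(k < n) box_vol (c k).1 (c k).2 =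
     \sum_(k < n) (if pickle_inv k is Some p then box_vol (b p).1 (b p).2 else 0).
    by apply: eq_bigr => k _; rewrite /c; case: pickle_inv.
  apply: le_trans (sum_pickle_inv (fun p => box_vol (b p).1 (b p).2) n M vol_ge0 HM) _.
  apply: (@le_trans _ _ (\sum_(i < M) eps / 2 ^+ i.+1)).
    apply: ler_sum => i _; have [_ _] := Hs i; apply: le_trans.
    exact: (@sum_nth_le _ _ (fun p => box_vol p.1 p.2) (0, 0) (s i) M (fun j => vol_ge0 (val i, j)) vol0).
  have -> : \sum_(i < M) eps / 2 ^+ i.+1 = eps - eps / 2 ^+ M.
    elim: (M) => [|m IH]; first by rewrite big_ord0 expr0 divr1 subrr.
    rewrite big_ord_recr /= IH exprS invfM; lra.
  by rewrite lerBlDr lerDl divr_ge0 ?exprn_ge0// ltW.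
Qed.

(** * Generic points have full measure *)

Lemma null_bigcup_countable {R : realType} {d : nat} {T : countType} (A : T -> set 'rV[R]_d) :
  (0 < d)%N -> (forall i, small_covers (A i)) -> lebesgue_null (\bigcup_i A i).
Proof.
move=> d0 HA; pose A' n : set 'rV[R]_d := if (pickle_inv n : option T) is Some i then A i else set0.
have -> : \bigcup_i A i = \bigcup_n A' n.
  apply/seteqP; split=> x [i _ Hx]; last first.
    by move: Hx; rewrite /A'; case: (pickle_inv i) => // j; exists j.
  by exists (pickle i); rewrite // /A' pickleK_inv.
apply: null_bigcup => // n eps eps0; rewrite /A'; case: pickle_inv => [i|]; first exact: HA.
by exists [::]; split=> //; rewrite big_nil ltW.
Qed.

Lemma small_power {R : realType} (r M eps : R) : 0 <= r < 1 -> 0 < M -> 0 < eps ->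
  exists k, r ^+ k * M <= eps.
Proof.
move=> /andP[r0 r1] M0 eps0.
have r11 : `|r| < 1 by rewrite ger0_norm.
have /cvgrPdist_lt/(_ _ (divr_gt0 eps0 M0))[k _ Hk] := cvg_expr r11.
exists k; have := Hk k (leqnn k); rewrite /= sub0r normrN ger0_norm ?exprn_ge0//.
by rewrite ltr_pdivlMr// => /ltW.
Qed.

(** Multiplication by [B] sends a cube of side p.2 into a box of side 2 q p.2; the resulting factor
    (2 q)^d is absorbed by enough rounds of [cover_iter]. *)
Lemma avoiding_small_covers {R : realType} {d : nat} (B D : 'M[R]_d) (y z : 'rV[R]_d) (eta t0 : R) :
  (0 < d)%N -> `|\det D| = 1 -> 0 < eta ->
  small_covers [set alpha | exists x, [/\ alpha = x *m B, cube z 1 x &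
    forall t, t0 <= t -> ~ hits y D eta x t]].
Proof.
move=> d0 dD eta0 eps eps0.
have [c /andP[c0 c1] Hc] := cover_iter y D eta t0 d0 dD eta0.
pose q : R := d%:R * `|B| + 1.
have q0 : 0 < q by rewrite ltr_wpDl// mulr_ge0.
have M0 : 0 < (2 * q) ^+ d by rewrite exprn_gt0// mulr_gt0.
have r01 : 0 <= 1 - c < 1 by rewrite subr_ge0 c1 ltrBlDr ltrDl.
have [k Hk] := small_power _ _ _ r01 M0 eps0.
have [s [s_gt0 s_sum s_cov]] := Hc k z 1 ltr01.
pose F (p : 'rV[R]_d * R) : 'rV[R]_d * 'rV[R]_d :=
  (p.1 *m B - const_mx (q * p.2), p.1 *m B + const_mx (q * p.2)).
exists [seq F p | p <- s]; split.
- move=> _ i /mapP[p /s_gt0 p0 ->]; rewrite !mxE lerD2l.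
  by apply: (@le_trans _ _ 0); rewrite ?oppr_le0 mulr_ge0// ltW.
- move=> _ [x [-> xz Hx]]; have [p ps xp] := s_cov x xz Hx.
  exists (F p); first exact: map_f.
  move=> i.
  have -> : (F p).1 ord0 i = (p.1 *m B) 0 i - q * p.2 by rewrite !mxE.
  have -> : (F p).2 ord0 i = (p.1 *m B) 0 i + q * p.2 by rewrite !mxE.
  have := mx_entry_le ((x - p.1) *m B) 0 i.
  have -> : ((x - p.1) *m B) 0 i = (x *m B) 0 i - (p.1 *m B) 0 i by rewrite mulmxBl !mxE.
  move=> h1.
  have p0 := s_gt0 _ ps.
  have xp2 : `|x - p.1| <= p.2.
    apply: mx_norm_le => [|i0 j]; first exact: ltW.
    by rewrite ord1 !mxE ler_norml; have /andP[] := xp j; lra.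
  have : `|(x *m B) 0 i - (p.1 *m B) 0 i| <= q * p.2.
    apply: le_trans h1 _; apply: le_trans (mx_norm_mul _ _) _.
    by rewrite mulrAC ler_pM ?mulr_ge0// /q lerDl.
  by rewrite ler_norml => /andP[]; lra.
- rewrite big_map; apply: le_trans Hk.
  apply: (@le_trans _ _ (\sum_(p <- s) (2 * q) ^+ d * p.2 ^+ d)); last first.
    by rewrite -mulr_sumr mulrC ler_wpM2r ?(ltW M0)// (le_trans s_sum)// expr1n mulr1.
  apply: ler_sum => p _; rewrite /box_vol.
  under eq_bigr => i _ do rewrite !mxE.
  rewrite (eq_bigr (fun=> 2 * q * p.2)) => [|i _]; last by ring.
  by rewrite prodr_const card_ord exprMn.
Qed.

Lemma rat_approx {R : realType} {d : nat} (y : 'rV[R]_d) (e : R) : 0 < e ->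
  exists y' : 'rV[rat]_d, `|map_mx ratr y' - y| < e.
Proof.
move=> e0.
have /choice[f Hf] : forall j, exists r : rat, `|ratr r - y 0 j| < e.
  move=> j; have [r] := @rat_in_itvoo R (y 0 j - e) (y 0 j + e) ltac:(lra).
  rewrite in_itv /= => /andP[r1 r2]; exists r; rewrite ltr_norml; lra.
exists (\row_j f j); apply: mx_norm_lt => // i j.
by rewrite ord1 !mxE; exact: Hf.
Qed.

(* [alpha *m invmx B] are the coordinates of [alpha] in the basis [B], for which the lattice is Z^d. *)
Definition generic {R : realType} {d : nat} (B D : 'M[R]_d) : set 'rV[R]_d :=
  [set alpha | forall y eta t0, 0 < eta ->
    exists2 t, t0 <= t & hits y D eta (alpha *m invmx B) t].

Lemma hits_close {R : realType} {d : nat} (y y' : 'rV[R]_d) (D : 'M[R]_d) (eta eta' : R) x t :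
  `|y' - y| <= eta' -> hits y' D eta x t -> hits y D (eta + eta') x t.
Proof.
move=> yy [G uG HG]; exists G => //.
have -> : zmx G *m horo x 1%:M *m flow d t - horo y D =
  (zmx G *m horo x 1%:M *m flow d t - horo y' D) + (horo y' D - horo y D) by rewrite addrA subrK.
apply: le_lt_trans (ler_normD _ _) _; apply: ltr_leD => //.
rewrite /horo opp_block_mx add_block_mx !subrr; have e0 := le_trans (normr_ge0 _) yy.
by apply: mx_norm_block_le; rewrite ?normr0.
Qed.

(** A failure for y, eta and t0 is also one for a rational first row within eta / 2 of y, a
    tolerance 1 / (k + 1) <= eta / 2 and an integer time above |t0|, inside the image of an integer
    unit cube: countably many sets to discard. *)
Lemma generic_full_measure {R : realType} {d : nat} (B D : 'M[R]_d) :
  (0 < d)%N -> B \in unitmx -> `|\det D| = 1 -> full_measure (generic B D).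
Proof.
move=> d0 uB dD.
pose I := ('rV[rat]_d * nat * nat * 'rV[int]_d)%type.
pose A (i : I) : set 'rV[R]_d := let: (y, k, t0, z) := i in
  [set alpha | exists x, [/\ alpha = x *m B, cube (zmx z) 1 x &
    forall t, t0%:R <= t -> ~ hits (map_mx ratr y) D (k.+1%:R^-1) x t]].
have null : lebesgue_null (\bigcup_i A i).
  apply: null_bigcup_countable => // -[[[y k] t0] z].
  by apply: avoiding_small_covers => //; rewrite invr_gt0.
move=> eps /null[a [b [ab cov vol]]]; exists a, b; split=> //.
apply: subset_trans cov => alpha nP.
move: nP => /existsNP[y /existsNP[eta /existsNP[t0 /not_implyP[eta0 nP]]]].
have e20 : 0 < eta / 2 by rewrite divr_gt0.
have [y' Hy'] := rat_approx y (eta / 2) e20.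
pose k := Num.truncn (2 / eta).
pose n0 := (Num.truncn `|t0|).+1.
pose z : 'rV[int]_d := \row_j Num.floor ((alpha *m invmx B) 0 j).
exists (y', k, n0, z) => //=.
exists (alpha *m invmx B); split; first by rewrite mulmxKV.
  move=> j; rewrite !mxE floor_le/= -[X in _ + X]/(1%:~R) -rmorphD ltW//; exact: floorD1_gt.
move=> t tt0 Ht; apply: nP; exists t.
  apply: le_trans (ler_norm _) _; apply: le_trans tt0; apply/ltW; exact: truncnS_gt.
have := hits_close y _ _ _ _ _ _ (ltW Hy') Ht.
case=> G uG HG; exists G => //; apply: lt_le_trans HG _.
have : k.+1%:R^-1 <= eta / 2.
  rewrite invf_ple ?posrE//.
  by rewrite invf_div; apply/ltW; exact: truncnS_gt.
by move: (k.+1%:R^-1) => w; lra.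
Qed.

(** * Distances under perturbation of the lattice *)

(** Back to the original bases: right multiplication by [horo 0 B], which commutes with the flow,
    costs only a constant factor in the tolerance. *)
Lemma generic_close {R : realType} {d : nat} (B B0 : 'M[R]_d) alpha alpha0 (eta t0 : R) :
  B \in unitmx -> generic B (B0 *m invmx B) alpha -> 0 < eta ->
  exists2 t, t0 <= t & exists2 G : 'M[int]_(1 + d), G \in unitmx &
    `|zmx G *m horo alpha B *m flow d t - horo alpha0 B0| < eta.
Proof.
move=> uB gen eta0; pose T : 'M[R]_(1 + d) := horo 0 B.
pose c : R := (1 + d)%:R * `|T| + 1.
have c0 : 0 < c by rewrite ltr_wpDl// mulr_ge0.
have [t tt0 [G uG HG]] := gen (alpha0 *m invmx B) (eta / c) t0 (divr_gt0 eta0 c0).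
exists t => //; exists G => //.
have -> : horo alpha B = horo (alpha *m invmx B) 1%:M *m T.
  by rewrite horoD mulmxKV// add0r.
have -> : horo alpha0 B0 = horo (alpha0 *m invmx B) (B0 *m invmx B) *m T.
  by rewrite /T /horo mulmx_block !mulmx1 !mulmx0 ?mul0mx !mulmxKV// ?addr0 ?add0r.
have TF : T *m flow d t = flow d t *m T.
  rewrite /T /horo /flow !mulmx_block !mulmx0 !mul0mx !mulmx1 !mul1mx !addr0 !add0r.
  by rewrite mul_mx_scalar mul_scalar_mx.
rewrite mulmxA -[_ *m T *m _]mulmxA TF mulmxA -mulmxBl.
apply: le_lt_trans (mx_norm_mul _ _) _.
apply: (@le_lt_trans _ _ ((1 + d)%:R * (eta / c) * `|T|)).
  by rewrite ler_wpM2r// ler_wpM2l// ltW.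
rewrite [X in X < _](_ : _ = (eta / c) * (c - 1)); last by rewrite /c; ring.
by rewrite mulrBr mulr1 divfK ?gt_eqF// ltrBlDr ltrDl divr_gt0.
Qed.

Lemma eucl_norm_ge0 {R : realType} {d : nat} (v : 'rV[R]_d) : 0 <= eucl_norm v.
Proof. exact: sqrtr_ge0. Qed.

Lemma eucl_normZ {R : realType} {d : nat} (a : R) (v : 'rV[R]_d) : 0 <= a ->
  eucl_norm (a *: v) = a * eucl_norm v.
Proof.
move=> a0; rewrite /eucl_norm.
rewrite (eq_bigr (fun i => a ^+ 2 * v ord0 i ^+ 2)) => [|i _]; last by rewrite mxE exprMn.
by rewrite -mulr_sumr sqrtrM ?sqr_ge0// sqrtr_sqr ger0_norm.
Qed.

Lemma mx_norm_le_eucl {R : realType} {d : nat} (v : 'rV[R]_d) : `|v| <= eucl_norm v.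
Proof.
apply: mx_norm_le => [|i j]; first exact: eucl_norm_ge0.
rewrite ord1 -sqrtr_sqr ler_sqrt ?sumr_ge0//; last by move=> k _; exact: sqr_ge0.
by rewrite (bigD1 j)//= lerDl sumr_ge0// => k _; exact: sqr_ge0.
Qed.

Lemma eucl_norm_eq0 {R : realType} {d : nat} (v : 'rV[R]_d) : (eucl_norm v == 0) = (v == 0).
Proof.
apply/eqP/eqP => [v0|->].
  by apply/eqP; rewrite -normr_eq0 eq_le normr_ge0 andbT -v0 mx_norm_le_eucl.
by rewrite /eucl_norm big1 ?sqrtr0// => i _; rewrite mxE expr0n.
Qed.

(** The squared difference of two square roots is at most the difference of the radicands, and the
    sums of squares are compared entrywise; hence the tolerance e^2 / c. *)
Lemma eucl_norm_close {R : realType} (d : nat) (rho e : R) : 0 <= rho -> 0 < e ->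
  exists2 k : R, 0 < k & forall a b : 'rV[R]_d, `|a| <= rho -> `|b - a| < k ->
    `|eucl_norm b - eucl_norm a| < e.
Proof.
move=> rho0 e0; pose c : R := d%:R * (2 * rho + 1) + 1.
have c0 : 0 < c by rewrite ltr_wpDl// mulr_ge0// addr_ge0// mulr_ge0.
exists (Num.min 1 (e ^+ 2 / c)); first by rewrite lt_min ltr01 divr_gt0// exprn_gt0.
move=> a b ar; rewrite lt_min => /andP[k1 k2].
pose A := \sum_(i < d) a ord0 i ^+ 2; pose B := \sum_(i < d) b ord0 i ^+ 2.
have A0 : 0 <= A by rewrite sumr_ge0// => i _; exact: sqr_ge0.
have B0 : 0 <= B by rewrite sumr_ge0// => i _; exact: sqr_ge0.
have AB : `|B - A| <= c * `|b - a|.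
  rewrite /A /B -sumrB (le_trans (ler_norm_sum _ _ _))//.
  apply: (@le_trans _ _ (\sum_(i < d) (2 * rho + 1) * `|b - a|)).
    apply: ler_sum => i _; rewrite subr_sqr normrM mulrC.
    have ba : `|b ord0 i - a ord0 i| <= `|b - a|.
      by have := mx_entry_le (b - a) ord0 i; rewrite !mxE.
    apply: ler_pM => //.
    have ai := le_trans (mx_entry_le a ord0 i) ar.
    have -> : b ord0 i + a ord0 i = (b ord0 i - a ord0 i) + 2 * a ord0 i by lra.
    rewrite (le_trans (ler_normD _ _))// normrM ger0_norm// addrC.
    by rewrite lerD ?ler_wpM2l// (le_trans ba)// ltW.
  rewrite sumr_const card_ord -[leLHS]mulr_natl mulrA ler_wpM2r//.
  by rewrite /c lerDl.
have {}AB : `|B - A| < e ^+ 2.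
  by apply: le_lt_trans AB _; rewrite mulrC -ltr_pdivlMr.
have : `|eucl_norm b - eucl_norm a| ^+ 2 <= `|B - A|.
  rewrite -[B in leRHS]sqr_sqrtr// -[A in leRHS]sqr_sqrtr// subr_sqr normrM expr2.
  apply: ler_wpM2l => //; rewrite [leRHS]ger0_norm ?addr_ge0 ?sqrtr_ge0//.
  rewrite -/(eucl_norm b) -/(eucl_norm a) (le_trans (ler_normB _ _))//.
  by rewrite !ger0_norm ?eucl_norm_ge0.
move=> /le_lt_trans/(_ AB) sq; rewrite -(@ltr_pXn2r _ 2)// nnegrE; exact: ltW.
Qed.

Lemma horo_point {R : realType} {d : nat} (alpha : 'rV[R]_d) (B : 'M[R]_d) (m : 'rV[int]_(1 + d)) :
  zmx m *m horo alpha B =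
  row_mx ((m 0 (lshift d 0))%:~R)%:M ((m 0 (lshift d 0))%:~R *: alpha + zmx (rsubmx m) *m B).
Proof.
rewrite -[m in LHS]hsubmxK (map_row_mx intr) /horo mul_row_block mulmx0 mulmx1 addr0.
rewrite [lsubmx m]mx11_scalar map_scalar_mx mul_scalar_mx mxE.
by congr (row_mx (_%:~R)%:M (_%:~R *: _ + _)); congr (m _ _); apply: val_inj.
Qed.

(** The set behind [delta], read off the lattice of [horo alpha B]: the first coordinate of [m] is
    the difference of the two indices, so adding [n] gives the index of the neighbour. *)
Definition gaps {R : realType} {d : nat} (alpha : 'rV[R]_d) (B : 'M[R]_d) (n N : nat) : set R :=
  [set r | exists m : 'rV[int]_(1 + d),
    [/\ 1 <= m 0 (lshift d 0) + n%:Z <= N%:Z, r = eucl_norm (rsubmx (zmx m *m horo alpha B)) & 0 < r]].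

Lemma deltaE {R : realType} {d : nat} (alpha : 'rV[R]_d) (B : 'M[R]_d) (n N : nat) :
  delta alpha B n N = inf (gaps alpha B n N).
Proof.
rewrite /delta; congr inf; apply/seteqP; split=> r /=.
  move=> [m [l [mN [z lz] rE r0]]].
  exists (row_mx (m%:Z - n%:Z)%:M z); split=> //.
    by rewrite row_mxEl mxE eqxx mulr1n subrK; lia.
  rewrite horo_point row_mxKr row_mxKr row_mxEl mxE eqxx mulr1n rE lz.
  by rewrite rmorphB.
move=> [m [mN -> r0]].
exists (absz (m 0 (lshift d 0) + n%:Z)), (zmx (rsubmx m) *m B); split=> //.
- by move: mN; lia.
- by exists (rsubmx m).
- rewrite horo_point row_mxKr; congr (eucl_norm (_ *: _ + _)).
  rewrite natr_absz ger0_norm; last by move: mN; lia.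
  by rewrite rmorphD/= addrK.
Qed.

Lemma mx_norm_rsub {R : realType} {m n1 n2 : nat} (A : 'M[R]_(m, n1 + n2)) : `|rsubmx A| <= `|A|.
Proof.
apply: mx_norm_le => // i j; rewrite mxE; exact: mx_entry_le.
Qed.

Lemma flow_point {R : realType} {d : nat} (alpha : 'rV[R]_d) (B : 'M[R]_d) (t : R) (m : 'rV[int]_(1 + d)) :
  zmx m *m horo alpha B *m flow d t =
  row_mx ((m 0 (lshift d 0))%:~R / t ^+ d)%:M (t *: rsubmx (zmx m *m horo alpha B)).
Proof.
rewrite horo_point row_mxKr /flow mul_row_block !mulmx0 addr0 add0r -scalar_mxM.
by rewrite mul_mx_scalar.
Qed.

Lemma horo_point0 {R : realType} {d : nat} (alpha : 'rV[R]_d) (B : 'M[R]_d) (m : 'rV[int]_(1 + d)) :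
  (zmx m *m horo alpha B) 0 (lshift d 0) = (m 0 (lshift d 0))%:~R.
Proof. by rewrite horo_point row_mxEl mxE eqxx mulr1n. Qed.

Lemma gaps_neq0 {R : realType} {d : nat} (alpha : 'rV[R]_d) (B : 'M[R]_d) (n N : nat) :
  (0 < d)%N -> B \in unitmx -> (1 <= n <= N)%N -> gaps alpha B n N !=set0.
Proof.
move=> d0 uB nN; pose l : 'rV[int]_d := delta_mx 0 (Ordinal d0).
pose m : 'rV[int]_(1 + d) := row_mx 0 l.
exists (eucl_norm (rsubmx (zmx m *m horo alpha B))); exists m; split=> //.
  by rewrite row_mxEl mxE add0r; lia.
rewrite lt_neqAle eucl_norm_ge0 andbT eq_sym eucl_norm_eq0.
rewrite horo_point row_mxKr row_mxKr row_mxEl mxE scale0r add0r.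
apply/negP => /eqP l0.
have /(congr1 (fun v => v *m invmx B)) := l0; rewrite mulmxK// mul0mx.
by move=> /rowP/(_ (Ordinal d0)); rewrite !mxE !eqxx => /eqP; rewrite oner_eq0.
Qed.

Lemma gaps_has_lb {R : realType} {d : nat} (alpha : 'rV[R]_d) (B : 'M[R]_d) (n N : nat) :
  lbound (gaps alpha B n N) 0.
Proof. by move=> r [m [_ _ /ltW]]. Qed.

(* [n'] approximates [(n - 1 / 2) t ^ d] rather than [n t ^ d]: the half shift keeps the lattice points
   away from the boundary of the window, which makes it stable under small perturbations. *)
Lemma delta_upper {R : realType} {d : nat} (alpha0 : 'rV[R]_d) (B0 : 'M[R]_d) (M n : nat) (e : R) :
  (0 < d)%N -> B0 \in unitmx -> (1 <= n <= M)%N -> 0 < e ->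
  exists2 eta : R, 0 < eta & forall alpha B t G (N n' : nat), 0 < t -> 8 <= t ^+ d ->
    `|zmx G *m horo alpha B *m flow d t - horo alpha0 B0| < eta ->
    `|N%:R / t ^+ d - M%:R| <= 1 / 8 -> `|n'%:R / t ^+ d - (n%:R - 1 / 2)| <= 1 / 8 ->
    exists2 r, gaps alpha B n' N r & t * r < delta alpha0 B0 n M + e.
Proof.
move=> d0 uB0 nM e0; rewrite deltaE.
have e20 : 0 < e / 2 by rewrite divr_gt0.
have hasinf : has_inf (gaps alpha0 B0 n M).
  by split; [exact: gaps_neq0|exists 0; exact: gaps_has_lb].
have [r0 [m [mM r0E r00]] r0e] := inf_adherent e20 hasinf.
pose h0 := horo alpha0 B0; pose w0 := zmx m *m h0.
have e10 : 0 < Num.min (e / 2) r0 by rewrite lt_min e20.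
have [k k0 Hk] := eucl_norm_close d `|w0| (Num.min (e / 2) r0) (normr_ge0 _) e10.
pose c : R := (1 + d)%:R * `|zmx m : 'rV[R]_(1 + d)| + 1.
have c0 : 0 < c by rewrite ltr_wpDl// mulr_ge0.
exists (Num.min k (1 / 8) / c); first by rewrite divr_gt0// lt_min k0 divr_gt0.
move=> alpha B t G N n' t0 t8 HG HN Hn'.
pose h := zmx G *m horo alpha B *m flow d t; pose w := zmx m *m h.
have ww0 : `|w - w0| < Num.min k (1 / 8).
  rewrite /w /w0 -mulmxBr; apply: le_lt_trans (mx_norm_mul _ _) _.
  apply: (@le_lt_trans _ _ (c * `|h - h0|)); first by rewrite ler_wpM2r// /c lerDl.
  by rewrite mulrC -ltr_pdivlMr.
move: ww0; rewrite lt_min => /andP[wk w8].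
have wE : w = row_mx (((m *m G) 0 (lshift d 0))%:~R / t ^+ d)%:M (t *: rsubmx (zmx (m *m G) *m horo alpha B)).
  by rewrite -flow_point map_mxM /w /h !mulmxA.
have T0 : 0 < t ^+ d by rewrite exprn_gt0.
set q := (m *m G) 0 (lshift d 0) in wE.
have uq : `|q%:~R / t ^+ d - (m 0 (lshift d 0))%:~R| < 1 / 8.
  apply: le_lt_trans w8; have := mx_entry_le (w - w0) 0 (lshift d 0).
  have -> : (w - w0) 0 (lshift d 0) = w 0 (lshift d 0) - w0 0 (lshift d 0) by rewrite !mxE.
  by rewrite horo_point0 wE row_mxEl mxE eqxx mulr1n.
have vk : `|eucl_norm (rsubmx w) - r0| < Num.min (e / 2) r0.
  have := Hk (rsubmx w0) (rsubmx w); rewrite -r0E; apply; first exact: mx_norm_rsub.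
  by rewrite -raddfB (le_lt_trans (mx_norm_rsub _))//.
rewrite wE row_mxKr eucl_normZ ?(ltW t0)// in vk.
set r := eucl_norm _ in vk.
exists r; last first.
  by move: vk; rewrite lt_min ltr_norml => /andP[/andP[_ v2] _]; lra.
exists (m *m G); rewrite -/q; split=> //; last first.
  move: vk; rewrite lt_min ltr_norml => /andP[_]; rewrite ltr_norml => /andP[v1 _].
  have : 0 < t * r by lra.
  by rewrite pmulr_rgt0.
have m1 : 1 <= (m 0 (lshift d 0))%:~R + n%:R :> R.
  by have /andP[] := mM; rewrite -(ler_int R) rmorphD.
have m2 : (m 0 (lshift d 0))%:~R + n%:R <= M%:R :> R.
  by have /andP[_] := mM; rewrite -(ler_int R) rmorphD.
move: uq HN Hn'; rewrite ltr_norml !ler_norml => /andP[u1 u2] /andP[N1 N2] /andP[n1 n2].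
rewrite -!(ler_int R) rmorphD/=.
have qE : q%:~R + n'%:R = (q%:~R / t ^+ d + n'%:R / t ^+ d) * t ^+ d :> R.
  by rewrite mulrDl !divfK ?gt_eqF.
have NE : N%:R = N%:R / t ^+ d * t ^+ d :> R by rewrite divfK ?gt_eqF.
rewrite -[n'%:Z%:~R]/(n'%:R) -[N%:Z%:~R]/(N%:R) qE; apply/andP; split.
  apply: (@le_trans _ _ (1 / 4 * t ^+ d)); first lra.
  by rewrite ler_wpM2r ?(ltW T0)//; lra.
rewrite NE ler_wpM2r ?(ltW T0)//; lra.
Qed.

Lemma abs_lt_window (q : int) (n M : nat) :
  1 <= q + n%:Z -> q + n%:Z <= M%:Z -> (1 <= n <= M)%N -> `|q| < M%:Z.
Proof. lia. Qed.

(** Too short a gap of the perturbed lattice would come, through the integer coordinates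
    [m *m invmx G], from a point of the target in the window at distance below [delta]. The freeness
    hypothesis rules out that this distance is 0. *)
Lemma delta_lower {R : realType} {d : nat} (alpha0 : 'rV[R]_d) (B0 : 'M[R]_d) (M n : nat) (e : R) :
  B0 \in unitmx -> (1 <= n <= M)%N -> 0 < e ->
  (forall (k : int) (l : 'rV[int]_d), `|k| < M%:Z -> k%:~R *: alpha0 + zmx l *m B0 = 0 -> k = 0) ->
  exists2 eta : R, 0 < eta & forall alpha B t G (N n' : nat), G \in unitmx -> 0 < t -> 8 <= t ^+ d ->
    `|zmx G *m horo alpha B *m flow d t - horo alpha0 B0| < eta ->
    `|N%:R / t ^+ d - M%:R| <= 1 / 8 -> `|n'%:R / t ^+ d - (n%:R - 1 / 2)| <= 1 / 8 ->
    forall r, gaps alpha B n' N r -> delta alpha0 B0 n M - e <= t * r.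
Proof.
move=> uB0 nM e0 free; rewrite deltaE; set S := gaps _ _ _ _; pose d0 := inf S.
have d00 : 0 <= d0.
  have [S0|S0] := pselect (S !=set0).
    by apply: lb_le_inf => //; exact: gaps_has_lb.
  by rewrite /d0 (_ : S = set0) ?inf0//; apply/eqP; rewrite -set0P in S0 *; apply: contra_notT S0.
pose h0 := horo alpha0 B0.
have uh0 : h0 \in unitmx by rewrite unitmxE det_horo -unitmxE.
pose k0 := invmx h0.
pose c : R := (1 + d)%:R * ((1 + d)%:R * `|k0|) + 1.
have c0 : 0 < c by rewrite ltr_wpDl// !mulr_ge0.
(* Bounds the vector of an offending gap: its first coordinate by M, the others by d0. *)
pose rho : R := d0 + M%:R + 1.
have rho0 : 0 < rho by rewrite ltr_wpDl// addr_ge0.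
have [k k_gt0 Hk] := eucl_norm_close d rho e (ltW rho0) e0.
pose k1 := Num.min k (1 / 8).
have k10 : 0 < k1 by rewrite lt_min k_gt0 divr_gt0.
exists (Num.min (1 / 2 / c) (k1 / (2 * rho) / c)).
  by rewrite lt_min !divr_gt0// mulr_gt0.
move=> alpha B t G N n' uG t0 t8 HG HN Hn' r [m [mN rE r0]].
rewrite leNgt; apply/negP => tr.
pose h := zmx G *m horo alpha B *m flow d t.
pose m' := m *m invmx G.
pose w := zmx m' *m h; pose w0 := zmx m' *m h0.
have wE : w = row_mx ((m 0 (lshift d 0))%:~R / t ^+ d)%:M (t *: rsubmx (zmx m *m horo alpha B)).
  by rewrite -flow_point -{1}[m](mulmxKV uG) map_mxM /w /h !mulmxA.
set q := m 0 (lshift d 0) in mN wE.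
have T0 : 0 < t ^+ d by rewrite exprn_gt0.
move: HN Hn'; rewrite !ler_norml => /andP[N1 N2] /andP[n1 n2].
have [nR MR] : 1 <= n%:R :> R /\ n%:R <= M%:R :> R by rewrite ler1n ler_nat; case/andP: nM.
have q1 : - (n%:R - 1 / 2) - 1 / 8 <= q%:~R / t ^+ d.
  have : - (n'%:R : R) <= q%:~R.
    have /andP[q1 _] := mN.
    have : 0 <= (q + n'%:Z)%:~R :> R by rewrite ler0z (le_trans _ q1).
    by rewrite rmorphD/= -[n'%:Z%:~R]/(n'%:R); lra.
  rewrite -(ler_pM2r (_ : 0 < (t ^+ d)^-1)) ?invr_gt0// mulNr; lra.
have q2 : q%:~R / t ^+ d <= M%:R - n%:R + 3 / 4.
  have : q%:~R + n'%:R <= N%:R :> R.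
    by have /andP[_] := mN; rewrite -(ler_int R) rmorphD.
  move=> qN; have : q%:~R / t ^+ d + n'%:R / t ^+ d <= N%:R / t ^+ d by rewrite -mulrDl ler_pM2r ?invr_gt0.
  lra.
have v_lt : eucl_norm (rsubmx w) < d0 - e by rewrite wE row_mxKr eucl_normZ ?(ltW t0)// -rE.
have wrho : `|w| <= rho.
  rewrite wE; apply: mx_norm_row_le.
    rewrite mx_norm11 mxE eqxx mulr1n ler_norml /rho; apply/andP; split; lra.
  have -> : t *: rsubmx (zmx m *m horo alpha B) = rsubmx w by rewrite wE row_mxKr.
  rewrite (le_trans (mx_norm_le_eucl _))// /rho; lra.
have m'E : zmx m' = w0 *m k0 by rewrite /w0 mulmxK.
have ww : `|w - w0| <= c * `|h - h0| * `|w0|.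
  rewrite /w {1}/w0 -mulmxBr m'E; apply: le_trans (mx_norm_mul _ _) _.
  apply: (@le_trans _ _ ((1 + d)%:R * ((1 + d)%:R * `|w0| * `|k0|) * `|h - h0|)).
    by rewrite ler_wpM2r// ler_wpM2l// mx_norm_mul.
  rewrite [leLHS](_ : _ = (1 + d)%:R * ((1 + d)%:R * `|k0|) * (`|h - h0| * `|w0|)); last by ring.
  by rewrite -[leRHS]mulrA ler_wpM2r ?mulr_ge0// lerDl.
move: HG; rewrite -/h -/h0 lt_min => /andP[h1 h2].
have ch1 : c * `|h - h0| <= 1 / 2 by rewrite mulrC -ler_pdivlMr// ltW.
have ch2 : c * `|h - h0| * (2 * rho) < k1 by rewrite -ltr_pdivlMr ?mulr_gt0// mulrC -ltr_pdivlMr.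
have w02 : `|w0| <= 2 * rho.
  have : `|w0| <= `|w| + `|w - w0|.
    by have := ler_normB w (w - w0); rewrite opprB addrC subrK.
  have : c * `|h - h0| * `|w0| <= 1 / 2 * `|w0| by rewrite ler_wpM2r.
  lra.
have {}ww : `|w0 - w| < k1.
  rewrite distrC; apply: le_lt_trans ww (le_lt_trans _ ch2).
  by rewrite ler_wpM2l// mulr_ge0// ltW.
move: ww; rewrite lt_min => /andP[wk w8].
have uq : `|(m' 0 (lshift d 0))%:~R - q%:~R / t ^+ d| < 1 / 8.
  apply: le_lt_trans w8; have := mx_entry_le (w0 - w) 0 (lshift d 0).
  have -> : (w0 - w) 0 (lshift d 0) = w0 0 (lshift d 0) - w 0 (lshift d 0) by rewrite !mxE.
  by rewrite horo_point0 wE row_mxEl [X in _ - X]mxE eqxx mulr1n.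
set q' := m' 0 (lshift d 0) in uq.
move: uq; rewrite ltr_norml => /andP[u1 u2].
(* The half shift leaves a margin at both ends: q' + n is above 1/4 here and below M + 7/8 next, and
   integrality gives 1 and M. *)
have q'1 : 1 <= q' + n%:Z.
  have : 0 < (q' + n%:Z)%:~R :> R by rewrite rmorphD/= -[n%:Z%:~R]/(n%:R); lra.
  by rewrite ltr0z gtz0_ge1.
have q'2 : q' + n%:Z <= M%:Z.
  have : (q' + n%:Z)%:~R < (M%:Z + 1)%:~R :> R.
    rewrite !rmorphD/= -[n%:Z%:~R]/(n%:R) -[M%:Z%:~R]/(M%:R); lra.
  by rewrite ltr_int ltzD1.
have vk : `|eucl_norm (rsubmx w0) - eucl_norm (rsubmx w)| < e.
  apply: Hk; first exact: le_trans (mx_norm_rsub _) _.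
  by rewrite -raddfB (le_lt_trans (mx_norm_rsub _)).
have v0lt : eucl_norm (rsubmx w0) < d0.
  by move: vk; rewrite ltr_norml => /andP[_]; lra.
(* At distance 0, freeness gives q' = 0, then m' = 0 and m = 0, against 0 < r. *)
have [v00|v00] := eqVneq (eucl_norm (rsubmx w0)) 0.
  move/eqP: v00; rewrite eucl_norm_eq0 /w0 horo_point row_mxKr => /eqP v00.
  have q'0 : q' = 0 by exact: (free _ (rsubmx m')) (abs_lt_window _ _ _ q'1 q'2 nM) v00.
  have l0 : rsubmx m' = 0.
    move: v00; rewrite -/q' q'0 scale0r add0r => /(congr1 (fun v => v *m invmx B0)).
    rewrite mulmxK// mul0mx => /rowP z0; apply/rowP => j; have := z0 j.
    by rewrite !mxE => /eqP; rewrite intr_eq0 => /eqP.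
  have m'0 : m' = 0.
    rewrite -[m']hsubmxK l0 [lsubmx m']mx11_scalar.
    have -> : lsubmx m' 0 0 = q' by rewrite mxE; congr (m' _ _); apply: val_inj.
    by rewrite q'0 raddf0 row_mx0.
  move: r0; rewrite rE; have -> : m = 0 by rewrite -[m](mulmxKV uG) -/m' m'0 mul0mx.
  by rewrite map_mx0 mul0mx raddf0 (eqP (_ : eucl_norm 0 == 0)) ?ltxx// eucl_norm_eq0.
have : d0 <= eucl_norm (rsubmx w0).
  apply: ge_inf; first by exists 0; exact: gaps_has_lb.
  exists m'; rewrite -/q'; split=> //; first by rewrite q'1 q'2.
  by rewrite lt_neqAle eq_sym v00 eucl_norm_ge0.
lra.
Qed.

Lemma delta_close {R : realType} {d : nat} (alpha0 : 'rV[R]_d) (B0 : 'M[R]_d) (M n : nat) (e : R) :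
  (0 < d)%N -> B0 \in unitmx -> (1 <= n <= M)%N -> 0 < e ->
  (forall (k : int) (l : 'rV[int]_d), `|k| < M%:Z -> k%:~R *: alpha0 + zmx l *m B0 = 0 -> k = 0) ->
  exists2 eta : R, 0 < eta & forall alpha B t G (N n' : nat), G \in unitmx -> 0 < t -> 8 <= t ^+ d ->
    `|zmx G *m horo alpha B *m flow d t - horo alpha0 B0| < eta ->
    `|N%:R / t ^+ d - M%:R| <= 1 / 8 -> `|n'%:R / t ^+ d - (n%:R - 1 / 2)| <= 1 / 8 ->
    `|t * delta alpha B n' N - delta alpha0 B0 n M| <= e.
Proof.
move=> d0 uB0 nM e0 free.
have [e1 e10 H1] := delta_upper alpha0 B0 M n e d0 uB0 nM e0.
have [e2 e20 H2] := delta_lower alpha0 B0 M n e uB0 nM e0 free.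
exists (Num.min e1 e2); first by rewrite lt_min e10.
move=> alpha B t G N n' uG t0 t8; rewrite lt_min => /andP[h1 h2] HN Hn'.
have [r rS rlt] := H1 _ _ _ _ _ _ t0 t8 h1 HN Hn'.
have low := H2 _ _ _ _ _ _ uG t0 t8 h2 HN Hn'.
have up : t * delta alpha B n' N <= t * r.
  rewrite ler_wpM2l ?(ltW t0)// deltaE; apply: ge_inf => //.
  by exists 0; exact: gaps_has_lb.
have lo : delta alpha0 B0 n M - e <= t * delta alpha B n' N.
  rewrite -ler_pdivrMl// [delta alpha _ _ _]deltaE; apply: lb_le_inf; first by exists r.
  by move=> s /low; rewrite ler_pdivrMl.
rewrite ler_norml; apply/andP; split; lra.
Qed.

Lemma uniform_small {R : realType} {T : finType} (P : T -> R -> Prop) :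
  (forall x e e', 0 < e' <= e -> P x e -> P x e') ->
  (forall x, exists2 e, 0 < e & P x e) -> exists2 e, 0 < e & forall x, P x e.
Proof.
move=> mono H; have /choice[f Hf] : forall x, exists e, 0 < e /\ P x e.
  by move=> x; have [e e0 Pe] := H x; exists e.
exists (\big[Num.min/1]_x f x).
  by apply: lt_bigmin => // x _; have [] := Hf x.
move=> x; have [fx Pfx] := Hf x; apply: mono Pfx; rewrite bigmin_le_cond// andbT.
by apply: lt_bigmin => // z _; have [] := Hf z.
Qed.

(** If phi x = phi y, then x and y are both within e of t phi x, so they coincide: phi is injective
    on the values of s. *)
Lemma size_undup_close {R : realType} (s s' : seq R) (phi : R -> R) (t e : R) :
  {in s &, forall x y, x != y -> 2 * e < `|x - y|} ->
  {in s, forall x, `|t * phi x - x| <= e} -> {in s, forall x, phi x \in s'} ->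
  (size (undup s) <= size (undup s'))%N.
Proof.
move=> sep near mem; rewrite -(size_map phi); apply: uniq_leq_size.
  rewrite map_inj_in_uniq ?undup_uniq// => x y; rewrite !mem_undup => xs ys pxy.
  apply/eqP/negPn/negP => /(sep _ _ xs ys).
  have := near x xs; have := near y ys; rewrite pxy.
  have := ler_distD (t * phi y) x y; rewrite (distrC x (t * phi y)); lra.
by move=> _ /mapP[x + ->]; rewrite !mem_undup => /mem.
Qed.

(** Take e so small that distinct distances of the target differ by more than 2 e. Each of them is
    within e of t times a distance of the perturbed lattice, so distinct ones stay distinct. *)
Lemma gN_ge {R : realType} {d : nat} (alpha0 : 'rV[R]_d) (B0 : 'M[R]_d) (M : nat) :
  (0 < d)%N -> B0 \in unitmx ->
  (forall (k : int) (l : 'rV[int]_d), `|k| < M%:Z -> k%:~R *: alpha0 + zmx l *m B0 = 0 -> k = 0) ->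
  exists2 eta : R, 0 < eta & forall alpha B t G (N : nat), G \in unitmx -> 0 < t -> 8 <= t ^+ d ->
    `|zmx G *m horo alpha B *m flow d t - horo alpha0 B0| < eta ->
    `|N%:R / t ^+ d - M%:R| <= 1 / 8 -> (gN alpha0 B0 M <= gN alpha B N)%N.
Proof.
move=> d0 uB0 free.
pose del (i : nat) := delta alpha0 B0 i.+1 M.
have [e e0 He] : exists2 e : R, 0 < e & forall p : 'I_M * 'I_M,
    del p.1 != del p.2 -> 2 * e < `|del p.1 - del p.2|.
  clearbody del.
  apply: (@uniform_small R ('I_M * 'I_M)%type (fun p e => del p.1 != del p.2 -> 2 * e < `|del p.1 - del p.2|)).
    by move=> x a b /andP[_ ba] H /H; apply: le_lt_trans; rewrite ler_wpM2l.
  move=> p; have [->|ne] := eqVneq (del p.1) (del p.2); first by exists 1.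
  have : 0 < `|del p.1 - del p.2| by rewrite normr_gt0 subr_eq0.
  move: `|_| => r r0; exists (r / 3); first by rewrite divr_gt0.
  by move=> _; rewrite mulrA ltr_pdivrMr// mulrC ltr_pM2l// ltr_nat.
pose Q (i : 'I_M) (eta : R) := forall alpha B t G (N n' : nat), G \in unitmx -> 0 < t -> 8 <= t ^+ d ->
    `|zmx G *m horo alpha B *m flow d t - horo alpha0 B0| < eta ->
    `|N%:R / t ^+ d - M%:R| <= 1 / 8 -> `|n'%:R / t ^+ d - (i.+1%:R - 1 / 2)| <= 1 / 8 ->
    `|t * delta alpha B n' N - del i| <= e.
have [eta eta0 Heta] : exists2 eta : R, 0 < eta & forall i, Q i eta.
  apply: uniform_small.
    move=> i a b /andP[b0 ba] H alpha B t G N n' uG t0 t8 h hN hn.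
    exact: (H _ _ _ _ _ _ uG t0 t8 (lt_le_trans h ba) hN hn).
  move=> i; apply: delta_close => //; exact: ltn_ord.
exists eta => // alpha B t G N uG t0 t8 HG HN.
have T0 : 0 < t ^+ d by rewrite exprn_gt0.
(* The index standing for n = i + 1; as t^d >= 8, rounding down costs at most t^d / 8 and the index
   is positive. *)
pose nn (i : nat) := Num.truncn ((i.+1%:R - 1 / 2) * t ^+ d).
have i1 (i : nat) : 1 <= i.+1%:R :> R by rewrite ler1n.
have nn1 i : (nn i)%:R <= (i.+1%:R - 1 / 2) * t ^+ d < (nn i)%:R + 1.
  rewrite natr1; apply: truncn_itv; rewrite mulr_ge0 ?(ltW T0)//; have := i1 i; lra.
have nn2 i : `|(nn i)%:R / t ^+ d - (i.+1%:R - 1 / 2)| <= 1 / 8.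
  have /andP[h1 h2] := nn1 i; rewrite ler_norml; apply/andP; split.
    rewrite lerBrDl ler_pdivlMr//; lra.
  by rewrite lerBlDl ler_pdivrMr//; lra.
have nnN i : (i < M)%N -> (1 <= nn i <= N)%N.
  move=> iM; have /andP[h1 h2] := nn1 i.
  have iM' : i.+1%:R <= M%:R :> R by rewrite ler_nat.
  apply/andP; split.
    have : 1 / 2 * 8 <= (i.+1%:R - 1 / 2) * t ^+ d by apply: ler_pM => //; have := i1 i; lra.
    rewrite -(ltr_nat R); lra.
  rewrite -(ler_nat R); apply: le_trans h1 _.
  move: HN; rewrite ler_norml => /andP[HN _].
  have : (M%:R - 1 / 8) * t ^+ d <= N%:R by rewrite -ler_pdivlMr//; lra.
  apply: le_trans; rewrite ler_wpM2r ?(ltW T0)//; lra.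
pose s0 := [seq delta alpha0 B0 n M | n <- iota 1 M].
pose s' := [seq delta alpha B n N | n <- iota 1 N].
pose phi x := delta alpha B (nn (index x s0)) N.
have sz : size s0 = M by rewrite size_map size_iota.
have idx x : x \in s0 -> (index x s0 < M)%N by rewrite -index_mem sz.
have idxE x : x \in s0 -> del (index x s0) = x.
  move=> xs; rewrite -[RHS](nth_index 0 xs) (nth_map 0%N) ?size_iota ?idx// nth_iota ?idx//.
have phiE x : x \in s0 -> `|t * phi x - x| <= e.
  move=> xs; have := Heta (Ordinal (idx x xs)) _ _ _ _ _ _ uG t0 t8 HG HN (nn2 (index x s0)).
  by rewrite /= idxE.
apply: (size_undup_close s0 s' phi t e) => [x y xs ys|x /phiE//|x xs].
  by have := He (Ordinal (idx x xs), Ordinal (idx y ys)); rewrite /= !idxE.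
by apply: map_f; rewrite mem_iota; have := nnN _ (idx x xs); rewrite add1n ltnS.
Qed.

(* [k alpha0] lies in the lattice, so the [M > |k|] consecutive multiples seen from any [n] realize
   all the classes modulo [k]: every [n] sees the same distances. *)
Lemma gN_degenerate {R : realType} {d : nat} (alpha0 : 'rV[R]_d) (B0 : 'M[R]_d) (M : nat) (k : int) (l : 'rV[int]_d) :
  `|k| < M%:Z -> k != 0 -> k%:~R *: alpha0 + zmx l *m B0 = 0 -> (gN alpha0 B0 M <= 1)%N.
Proof.
move=> kM k0 kl.
suff same n n' : (1 <= n <= M)%N -> (1 <= n' <= M)%N -> gaps alpha0 B0 n M `<=` gaps alpha0 B0 n' M.
  apply: (@leq_trans (size [:: delta alpha0 B0 1 M])) => //.
  apply: uniq_leq_size; first exact: undup_uniq.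
  move=> x; rewrite mem_undup => /mapP[n]; rewrite mem_iota add1n ltnS => nM ->.
  rewrite inE !deltaE; apply/eqP; congr inf; apply/seteqP.
  have M1 : (1 <= 1 <= M)%N by move: nM; case: (M) => [|//]; lia.
  by split; apply: same.
move=> nM n'M r [m [mM rE r0]].
have [j Hj] : exists j : int, 1 <= m 0 (lshift d 0) + j * k + n'%:Z <= M%:Z.
  pose a := m 0 (lshift d 0) + n'%:Z - 1; exists (- (a %/ k)%Z).
  have aE : m 0 (lshift d 0) - (a %/ k)%Z * k + n'%:Z = (a %% k)%Z + 1.
    by rewrite /modz /a; ring.
  rewrite mulNr aE lerDr modz_ge0//= -ltzD1 ltrD2r.
  exact: lt_trans (ltz_mod _ k0) kM.
exists (m + row_mx (j * k)%:M (j *: l)); split=> //.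
  by rewrite mxE row_mxEl mxE eqxx mulr1n.
rewrite rE !horo_point !row_mxKr; congr (eucl_norm _).
have -> : rsubmx (m + row_mx (j * k)%:M (j *: l)) = rsubmx m + j *: l.
  by apply/rowP => i; rewrite !mxE (unsplitK (inr _)) mxE.
have -> : (m + row_mx (j * k)%:M (j *: l)) 0 (lshift d 0) = m 0 (lshift d 0) + j * k.
  by rewrite mxE row_mxEl mxE eqxx mulr1n.
rewrite map_mxD map_mxZ/= mulmxDl -scalemxAl.
by rewrite intrD scalerDl intrM -scalerA addrACA -scalerDr kl scaler0 addr0.
Qed.

(** * The theorem *)

Lemma limn_esup_ge {R : realType} (u : nat -> \bar R) (x : \bar R) :
  (forall i0, exists2 i, (i0 <= i)%N & (x <= u i)%E) -> (x <= limn_esup u)%E.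
Proof.
move=> H; apply: le_ereal_inf_tmp => _ [V [n _ nV] <-].
have [i ni xi] := H n; apply: le_trans xi _; apply: ereal_sup_ubound.
by exists i => //; exact: nV.
Qed.

(** Take the last N_i <= X. As N_(i+1) > X and consecutive ratios are within eps of 1, N_i / X is at
    least 1 - eps. Requiring X >= N_j puts this index at j or later. *)
Lemma subexponential_hit {R : realType} (N : nat -> nat) (eps : R) (i0 : nat) :
  subexponential R N -> 0 < eps ->
  exists X0 : R, forall X, X0 <= X -> 0 < X -> exists2 i, (i0 <= i)%N & `|(N i)%:R / X - 1| <= eps.
Proof.
move=> [Npos Nlt /cvgrPdist_lt cvg] eps0; have [i1 _ H1] := cvg _ eps0.
pose j := maxn i0 i1; exists (N j)%:R => X NX X0.
have Nge k : (k <= N k)%N by elim: k => // k IH; exact: leq_ltn_trans IH (Nlt k).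
have ex : exists k, (j < k)%N && (X < (N k)%:R).
  exists (maxn j.+1 (Num.truncn X).+1); rewrite leq_max leqnn/=.
  by apply: lt_le_trans (truncnS_gt X) _; rewrite ler_nat (leq_trans _ (Nge _))// leq_maxr.
have [k /andP[jk Xk] kmin] := ex_minnP ex.
have [i ki] : exists i, k = i.+1 by case: (k) jk => // i; exists i.
have ji : (j <= i)%N by rewrite -ltnS -ki.
exists i; first by rewrite (leq_trans _ ji)// leq_maxl.
have NiX : (N i)%:R <= X.
  move: ji; rewrite leq_eqVlt => /orP[/eqP <-//|ji].
  rewrite leNgt; apply/negP => Xi.
  by have := kmin i; rewrite ji Xi ki => /(_ isT); rewrite ltnn.
have Ni0 : 0 < (N i)%:R :> R by rewrite ltr0n.
have : `|1 - (N i.+1)%:R / (N i)%:R| < eps by apply: H1; rewrite /= (leq_trans _ ji)// leq_maxr.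
rewrite ltr_norml => /andP[h _].
have h2 : (N i.+1)%:R < (1 + eps) * (N i)%:R :> R.
  by rewrite -ltr_pdivrMr//; lra.
have h3 : X < (1 + eps) * X + (1 + eps) * ((N i)%:R - X).
  by rewrite -mulrDr addrCA subrr addr0; rewrite ki in Xk; exact: lt_trans Xk h2.
rewrite ler_norml; apply/andP; split; last first.
  by rewrite (@le_trans _ _ 0) ?(ltW eps0)// subr_le0 ler_pdivrMr// mul1r.
rewrite lerBrDl ler_pdivlMr//.
have : eps * ((N i)%:R - X) <= 0 by rewrite mulr_ge0_le0 ?subr_le0// ltW.
lra.
Qed.

Lemma gN_gt0 {R : realType} {d : nat} (alpha : 'rV[R]_d) (B : 'M[R]_d) (N : nat) :
  (0 < N)%N -> (0 < gN alpha B N)%N.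
Proof.
case: N => // N _; rewrite /gN lt0n size_eq0; apply/eqP => /(congr1 (fun s => delta alpha B 1 N.+1 \in s)).
by rewrite mem_undup /= inE eqxx.
Qed.

Theorem theorem1p2 (R : realType) (d : nat) (B B0 : 'M[R]_d) :
  (2 <= d)%N -> unimodular B -> unimodular B0 ->
  exists P : set 'rV[R]_d, full_measure P /\
    forall alpha, P alpha -> forall (alpha0 : 'rV[R]_d) (N : nat -> nat),
      subexponential R N ->
      (limn_esup (fun i => ((gN alpha B (N i))%:R : R)%:E)
         >= ereal_sup [set ((gN alpha0 B0 M)%:R : R)%:E | M in [set: nat]])%E.
Proof.
move=> d2 B1 B01; have d0 : (0 < d)%N by exact: leq_trans d2.
have uB : B \in unitmx by rewrite unitmxE unitfE -normr_gt0 B1.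
have uB0 : B0 \in unitmx by rewrite unitmxE unitfE -normr_gt0 B01.
have dD : `|\det (B0 *m invmx B)| = 1.
  by rewrite det_mulmx det_inv normrM normfV B1 B01 invr1 mulr1.
exists (generic B (B0 *m invmx B)); split; first exact: generic_full_measure.
move=> alpha gen alpha0 N Nsub; apply: ge_ereal_sup => _ [M _ <-].
apply: limn_esup_ge => i0.
suff [i ii iM] : exists2 i, (i0 <= i)%N & (gN alpha0 B0 M <= gN alpha B (N i))%N.
  by exists i => //; rewrite lee_fin ler_nat.
have N0 i : (0 < N i)%N by have [] := Nsub.
have [->|M0] := posnP M; first by exists i0.
have [[k [l [kM k0 kl]]]|free] := pselect (exists k : int, exists l : 'rV[int]_d,
    [/\ `|k| < M%:Z, k != 0 & k%:~R *: alpha0 + zmx l *m B0 = 0]).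
  exists i0 => //; apply: leq_trans (gN_degenerate alpha0 B0 M k l kM k0 kl) _.
  exact: gN_gt0.
have {}free (k : int) (l : 'rV[int]_d) : `|k| < M%:Z -> k%:~R *: alpha0 + zmx l *m B0 = 0 -> k = 0.
  move=> kM kl; apply/eqP/negPn/negP => k0; apply: free; exists k, l; split=> //.
have [eta eta0 Heta] := gN_ge alpha0 B0 M d0 uB0 free.
have MR : 0 < M%:R :> R by rewrite ltr0n.
(* Multiplied by M, this tolerance on N_i / (M t^d) becomes the 1/8 on N_i / t^d that [gN_ge] asks
   for. *)
have eps0 : 0 < 1 / 8 / M%:R :> R by rewrite !divr_gt0.
have [X0 HX0] := subexponential_hit N _ i0 Nsub eps0.
(* The scale is chosen last: t >= 8 + |X0| yields both t^d >= 8 and M t^d >= X0. *)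
have [t t_ge [G uG HG]] := generic_close B B0 alpha alpha0 eta (8 + `|X0|) uB gen eta0.
have t8 : 8 <= t by rewrite (le_trans _ t_ge)// lerDl.
have tX : X0 <= t.
  by rewrite (le_trans (ler_norm _))// (le_trans _ t_ge)// lerDr.
have t0 : 0 < t by exact: lt_le_trans t8.
have td : t <= t ^+ d by rewrite ler_eXnr// (le_trans _ t8)// ler1n.
have T0 : 0 < t ^+ d by rewrite exprn_gt0.
have MT : t <= M%:R * t ^+ d by rewrite (le_trans td)// ler_peMl ?(ltW T0)// ler1n.
have [i ii Hi] := HX0 (M%:R * t ^+ d) (le_trans tX MT) (mulr_gt0 MR T0).
exists i => //; apply: Heta uG t0 (le_trans t8 td) HG _.
have -> : (N i)%:R / t ^+ d - M%:R = M%:R * ((N i)%:R / (M%:R * t ^+ d) - 1).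
  by field; rewrite !gt_eqF.
by rewrite normrM gtr0_norm// mulrC -ler_pdivlMr.
Qed.
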